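(* Let $\mathbb K\in\{\mathbb R,\mathbb C\}$ and $1\le p<\infty$. Then, as $d\to\infty$, $$\mathbf c(\ell_p^d(\mathbb K))\asymp \sqrt d \ \text{ if } p\ge 2,\qquad \mathbf c(\ell_p^d(\mathbb K))\asymp \sqrt[p]{d}\ \text{ if } p\le 2.$$ For $p=\infty$: $\sqrt d\prec \mathbf c(\ell_\infty^d(\mathbb K))\prec\sqrt{d\log d}$.
   Context: For a Banach space $X$ over $\mathbb K$ and $n\in\mathbb N$, $\mathbf c_n(X)$ is the smallest constant such that for all $\psi_1,\dots,\psi_n\in X^*$, $\|\psi_1\|\cdots\|\psi_n\|\le \mathbf c_n(X)\,\|\psi_1\cdots\psi_n\|$, where $\psi_1\cdots\psi_n$ is the pointwise product and $\|P\|=\sup_{\|x\|=1}|P(x)|$; $\mathbf c(X)=\lim_{n\to\infty}\mathbf c_n(X)^{1/n}$ (this limit exists). $\ell_p^d(\mathbb K)$ is $\mathbb K^d$ with the $p$-norm. For positive sequences, $a_d\prec b_d$ means there is a constant $L>0$ (independent of $d$, possibly depending on $p$ and $\mathbb K$) with $a_d\le L b_d$ for all $d$; $a_d\asymp b_d$ means $a_d\prec b_d$ and $b_d\prec a_d$. *)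

(* Defs.v *)
From HB Require Import structures.
From mathcomp Require Import all_boot all_order all_algebra.
From mathcomp Require Import all_classical all_reals all_analysis.
From mathcomp Require Import complex.
Set Implicit Arguments. Unset Strict Implicit. Unset Printing Implicit Defensive.
Import Order.TTheory GRing.Theory Num.Theory.
Local Open Scope classical_set_scope.
Local Open Scope ring_scope.

Section Polarization.
Variables (R : realType) (K : comNzRingType) (mK : K -> R).
(* mK is the modulus |.| : K -> R of the scalar field K *)

Definition lpnorm (p : R) (d : nat) (x : 'rV[K]_d) : R :=
  (\sum_(i < d) mK (x 0 i) `^ p) `^ p^-1.

Definition linfnorm (d : nat) (x : 'rV[K]_d) : R :=
  \big[Num.max/0]_(i < d) mK (x 0 i).

Definition is_linear_functional (d : nat) (f : 'rV[K]_d -> K) : Prop :=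
  forall (c : K) (x y : 'rV[K]_d), f (c *: x + y) = c * f x + f y.

Definition supnorm (d : nat) (N : 'rV[K]_d -> R) (P : 'rV[K]_d -> K) : R :=
  sup [set mK (P x) | x in [set x | N x = 1]].

Definition cn (d : nat) (N : 'rV[K]_d -> R) (n : nat) : R :=
  inf [set C : R | 0 <= C /\
    forall psi : 'I_n -> 'rV[K]_d -> K,
      (forall i, is_linear_functional (psi i)) ->
      \prod_(i < n) supnorm N (psi i)
        <= C * supnorm N (fun x => \prod_(i < n) psi i x)].

Definition cconst (d : nat) (N : 'rV[K]_d -> R) : R :=
  lim ((fun n : nat => cn N n.+1 `^ (n.+1%:R)^-1) @ \oo).

End Polarization.

Definition prec (R : realType) (d0 : nat) (a b : nat -> R) : Prop :=
  exists L : R, 0 < L /\ forall d : nat, (d0 <= d)%N -> a d <= L * b d.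

Definition asymp (R : realType) (d0 : nat) (a b : nat -> R) : Prop :=
  prec d0 a b /\ prec d0 b a.

Definition theorem2p1_for (R : realType) (K : comNzRingType) (mK : K -> R) : Prop :=
  (forall p : R, 1 <= p ->
     (2 <= p -> asymp 1 (fun d => cconst mK (lpnorm mK p (d := d)))
                        (fun d => Num.sqrt (d%:R)))
  /\ (p <= 2 -> asymp 1 (fun d => cconst mK (lpnorm mK p (d := d)))
                        (fun d => (d%:R : R) `^ p^-1)))
  /\ prec 2 (fun d => Num.sqrt (d%:R)) (fun d => cconst mK (linfnorm mK (d := d)))
  /\ prec 2 (fun d => cconst mK (linfnorm mK (d := d)))
            (fun d => Num.sqrt (d%:R * ln (d%:R))).

(* Main.v *)
(* Splitting a product shows that c_m c_n <= c_(m+n), so by Fekete's lemma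
   c(X) = sup_n c_n^(1/n).

   Lower bounds come from explicit families of functionals: the d coordinates
   (giving d^(1/p)) and all 2^d sign functionals (giving sqrt d for p >= 2), the
   product being controlled by the arithmetic-geometric mean inequality.

   For the upper bound one wants a random real point y with
   E ln |<a, y>| >= ln |a|_2 - O(1) for every a, and with y of norm
   O(d^(1/p)) (O(sqrt (ln d)) for p = oo); Gaussian y would do. The Gaussian is
   replaced by a walk of tiny signed steps along the coordinate axes, each sign
   being chosen so that the sum over j of a potential of <a_j, y>, minus a multiple
   of the sum of cosh (lambda y_i), does not drop below its conditional average.
   The logarithm is regularised as ln (x^2 + eta) / 2, and eta tends to 0 at the
   end, by homogeneity of the norm. Complex functionals are replaced by their
   real or imaginary part, whichever has the larger Euclidean norm. *)

Require Import Defs.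
From HB Require Import structures.
From mathcomp Require Import all_boot all_order all_algebra.
From mathcomp Require Import all_classical all_reals all_analysis.
From mathcomp Require Import complex.
From mathcomp Require Import ring lra.
Set Implicit Arguments. Unset Strict Implicit. Unset Printing Implicit Defensive.
Import Order.TTheory GRing.Theory Num.Theory.
Import numFieldNormedType.Exports.
Local Open Scope classical_set_scope.
Local Open Scope ring_scope.

(** * Elementary inequalities *)

Lemma ln_leB1 (R : realType) (x : R) : 0 < x -> ln x <= x - 1.
Proof. by move=> x0; rewrite -[x in ln x](subrKC 1) le_ln1Dx //; lra. Qed.

(** The tangent bound for [ln] at [(1 + y)^-1] gives the lower bound [y / (1 + y)], which dominates
    the quadratic when [|y| <= 1/2]. *)
Lemma ln1D_ge (R : realType) (y : R) : `|y| <= 1 / 2 -> y - 2 * y ^+ 2 <= ln (1 + y).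
Proof.
move=> hy; have /andP[y1 y2] : (- (1 / 2) <= y) && (y <= 1 / 2) by rewrite -ler_norml.
have y0 : 0 < 1 + y by lra.
have h : ln ((1 + y)^-1) <= (1 + y)^-1 - 1.
  by apply: ln_leB1; rewrite invr_gt0.
rewrite lnV ?posrE // in h.
have e : (1 + y)^-1 - 1 = - y / (1 + y) by (field; rewrite gt_eqF).
rewrite e in h.
have : - y / (1 + y) <= - y + 2 * y ^+ 2.
  rewrite ler_pdivrMr //; have := sqr_ge0 y; nra.
lra.
Qed.

Lemma expr_powRVn (R : realType) (x : R) (n : nat) : 0 <= x ->
  (x ^+ n.+1) `^ (n.+1%:R)^-1 = x.
Proof. by move=> x0; rewrite -powR_mulrn // -powRrM divff ?pnatr_eq0 // powRr1. Qed.

Lemma powRVn_expr (R : realType) (x : R) (n : nat) : 0 <= x ->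
  (x `^ (n.+1%:R)^-1) ^+ n.+1 = x.
Proof. by move=> x0; rewrite -powR_mulrn ?powR_ge0 // -powRrM mulVf ?pnatr_eq0 // powRr1. Qed.

Lemma powR_powRV (R : realType) (p x : R) : p != 0 -> 0 <= x -> (x `^ p) `^ p^-1 = x.
Proof. by move=> p0 x0; rewrite -powRrM divff // powRr1. Qed.

Lemma powRV_powR (R : realType) (p x : R) : p != 0 -> 0 <= x -> (x `^ p^-1) `^ p = x.
Proof. by move=> p0 x0; rewrite -powRrM mulVf // powRr1. Qed.

Lemma prod_powR (R : realType) (I : finType) (F : I -> R) (r : R) :
  (forall i, 0 <= F i) -> \prod_i (F i `^ r) = (\prod_i F i) `^ r.
Proof.
move=> F0.
suff [_ ->] : 0 <= \prod_i F i /\ \prod_i (F i `^ r) = (\prod_i F i) `^ r by [].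
elim/big_rec2: _ => [|i y z _ [z0 ->]]; first by rewrite powR1.
by rewrite mulr_ge0 // powRM.
Qed.

(** Weighted AM-GM: with [w] the right-hand side, the tangent bounds for [ln (s / w)] and [ln w^-1],
    weighted by [theta] and [1 - theta], add up to 0. *)
Lemma powR_le_affine (R : realType) (s theta : R) : 0 <= s -> 0 <= theta <= 1 ->
  s `^ theta <= 1 - theta + theta * s.
Proof.
move=> s0 /andP[t0 t1]; move: s0; rewrite le_eqVlt => /predU1P[<-|s0].
  have [->|tn0] := eqVneq theta 0; first by rewrite powRr0; lra.
  by rewrite powR0 //; lra.
set w := _ + _; have w0 : 0 < w by rewrite /w; nra.
have hs : ln s - ln w <= s / w - 1.
  by rewrite -ln_div ?posrE // ln_leB1 // divr_gt0.
have h1 : - ln w <= w^-1 - 1.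
  by rewrite -lnV ?posrE // ln_leB1 // invr_gt0.
rewrite -(lnK (s0 : s \is Num.pos)) -expRM -[leRHS](lnK (w0 : w \is Num.pos)) ler_expR.
have e : theta * (s / w - 1) + (1 - theta) * (w^-1 - 1) = 0.
  have -> : theta * (s / w - 1) + (1 - theta) * (w^-1 - 1) = w / w - 1.
    by rewrite {3}/w; field; rewrite gt_eqF.
  by rewrite divff ?subrr // gt_eqF.
nra.
Qed.

Lemma prod_le_mean_exp (R : realType) (I : finType) (F : I -> R) (b : R) :
  (0 < #|I|)%N -> (forall i, 0 <= F i) -> \sum_i F i <= b *+ #|I| ->
  \prod_i F i <= b ^+ #|I|.
Proof.
move=> I0 F0 hF; have IR : 0 < #|I|%:R :> R by rewrite ltr0n.
have [+ _] := leif_AGM (fun i (_ : i \in I) => F0 i).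
move/le_trans; apply; apply: lerXn2r.
- by rewrite nnegrE divr_ge0 ?sumr_ge0.
- rewrite nnegrE -(pmulr_lge0 _ IR) mulr_natr; apply: le_trans hF; exact: sumr_ge0.
- by rewrite ler_pdivrMr // mulr_natr.
Qed.

(** [C] depends on [n] and [L] but not on [r]. This uniformity lets a regularisation be removed
    although the values [r] change with it. *)
Lemma prod_perturb (R : realType) (n : nat) (L : R) : 0 <= L ->
  exists2 C : R, 0 <= C & forall (r : 'I_n -> R) e,
    (forall j, 0 <= r j <= L) -> 0 <= e <= 1 ->
    \prod_j (r j + e) <= \prod_j r j + C * e.
Proof.
move=> L0; elim: n => [|n [C C0 IH]].
  by exists 0 => // r e _ _; rewrite !big_ord0 mul0r addr0.
exists (L ^+ n + C * (L + 1)).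
  by rewrite addr_ge0 ?exprn_ge0 // mulr_ge0 // addr_ge0.
move=> r e hr /andP[e0 e1]; rewrite !big_ord_recr /=.
have {}IH := IH (fun j => r (widen_ord (leqnSn n) j)) e (fun j => hr _).
rewrite e0 e1 in IH; have {}IH := IH isT.
have /andP[rn0 rnL] := hr ord_max.
have hP : \prod_(j < n) r (widen_ord (leqnSn n) j) <= L ^+ n.
  rewrite -[n in leRHS]card_ord -prodr_const; apply: ler_prod => j _; exact: hr.
have rn1 : 0 <= r ord_max + e by rewrite addr_ge0.
apply: le_trans (ler_wpM2r rn1 IH) _.
set P := \prod_(j < n) _ in hP *; set x := r _ in rn0 rnL *.
have h1 : P * e <= L ^+ n * e by rewrite ler_wpM2r.
have h2 : C * e * (x + e) <= C * e * (L + 1) by rewrite ler_wpM2l ?mulr_ge0 // lerD.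
rewrite mulrDl mulrDr [_ * e in leRHS]mulrDl.
have -> : C * (L + 1) * e = C * e * (L + 1) by ring.
by rewrite -addrA lerD2l lerD.
Qed.

(** Distinct signs are uncorrelated, since flipping the sign at [i] negates the sum of their
    products; only the diagonal terms survive. *)
Lemma sum_sign_sqr (R : realType) (d : nat) (r : 'I_d -> R) :
  \sum_(eps : {ffun 'I_d -> bool}) (\sum_i (-1) ^+ eps i * r i) ^+ 2
  = (\sum_i r i ^+ 2) *+ #|{ffun 'I_d -> bool}|.
Proof.
have corr i k : i != k ->
    \sum_(eps : {ffun 'I_d -> bool}) ((-1) ^+ eps i * (-1) ^+ eps k) = 0 :> R.
  move=> ik; set s := \sum_eps _.
  pose flip (eps : {ffun 'I_d -> bool}) := [ffun l => eps l (+) (l == i)].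
  have flipK : involutive flip.
    by move=> eps; apply/ffunP => l; rewrite !ffunE -addbA addbb addbF.
  have : s = - s.
    rewrite {1}/s (reindex_inj (inv_inj flipK)) /= -sumrN; apply: eq_bigr => eps _.
    rewrite !ffunE eqxx eq_sym (negPf ik) addbF addbT.
    by case: (eps i); rewrite ?mulN1r ?mul1r ?opprK.
  lra.
under eq_bigr => eps _.
  rewrite expr2 mulr_suml.
  under eq_bigr do rewrite mulr_sumr.
  over.
rewrite exchange_big /= -sumrMnl; apply: eq_bigr => i _.
rewrite exchange_big (bigD1 i) //= [X in _ + X]big1 ?addr0 => [|k ki].
  under eq_bigr => eps _.
    have -> : (-1) ^+ eps i * r i * ((-1) ^+ eps i * r i) = r i ^+ 2.
      by rewrite -expr2 exprMn sqrr_sign mul1r.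
    over.
  by rewrite sumr_const.
under eq_bigr => eps _ do rewrite mulrACA.
by rewrite -mulr_suml corr ?mul0r // eq_sym.
Qed.

Definition cosh (R : realType) (t : R) : R := (expR t + expR (- t)) / 2.

(** For small [t], [expR t <= (1 - t)^-1] and its mirror image average to [(1 - t ^+ 2)^-1]. For
    large [t], already [|t| <= 2 * t ^+ 2]. *)
Lemma cosh_le_expR_sqr (R : realType) (t : R) : cosh t <= expR (2 * t ^+ 2).
Proof.
have [t1|t1] := lerP (t ^+ 2) (1 / 2).
  have t2 : -1 < t < 1 by apply/andP; split; nra.
  case/andP: t2 => t2 t3.
  have h1 : expR t <= (1 - t)^-1.
    rewrite -[t in expR t]opprK expRN lef_pV2 ?posrE ?expR_gt0 //; last lra.
    exact: expR_ge1Dx.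
  have h2 : expR (- t) <= (1 + t)^-1.
    rewrite expRN lef_pV2 ?posrE ?expR_gt0 //; last lra.
    exact: expR_ge1Dx.
  have h3 : (1 - t)^-1 + (1 + t)^-1 = 2 / (1 - t ^+ 2).
    by field; rewrite !gt_eqF //; nra.
  have h4 : 2 / (1 - t ^+ 2) <= 2 * (1 + 2 * t ^+ 2).
    by rewrite ler_pdivrMr; have := sqr_ge0 t; nra.
  have := expR_ge1Dx (2 * t ^+ 2).
  rewrite /cosh; lra.
have h1 : expR t <= expR (2 * t ^+ 2) by rewrite ler_expR; nra.
have h2 : expR (- t) <= expR (2 * t ^+ 2) by rewrite ler_expR; nra.
rewrite /cosh; lra.
Qed.

Lemma coshD_sub (R : realType) (t h : R) :
  (cosh (t + h) + cosh (t - h)) / 2 = cosh t * cosh h.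
Proof. by rewrite /cosh !opprD opprK !expRD; field. Qed.

Lemma cosh_ge0 (R : realType) (t : R) : 0 <= cosh t.
Proof. by rewrite /cosh divr_ge0 ?addr_ge0 ?expR_ge0. Qed.

Lemma expR_norm_le_cosh (R : realType) (t : R) : expR `|t| <= 2 * cosh t.
Proof.
rewrite mulrC divfK ?pnatr_eq0 //.
by case: (ger0P t) => _; rewrite ?lerDl ?lerDr expR_ge0.
Qed.

(** * A derandomised random walk *)

(** What remains of [potential_step] after scaling by [x ^+ 2 + s] and taking out a factor [b]: here
    [a] and [b] are the ratios of the squared position and of the squared step to [x ^+ 2 + s]. *)
Lemma potential_step_rational (R : realType) (a b : R) : 0 <= a <= 1 -> 0 <= b <= 1/64 ->
  0 <= 1/2 - a - 9 / 4 * b - 4 + 8 * (a * 8 / (1 + 8 * b) + (1 - a) * (1 + b - 4 * a) / ((1 + b)^+2 - 4 * a * b)).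
Proof.
move=> /andP[a0 a1] /andP[b0 b1].
have h1 : a * (64/9) <= a * 8 / (1 + 8 * b).
  by rewrite ler_pdivlMr; nra.
have D0 : 15/16 <= (1 + b)^+2 - 4 * a * b by nra.
have h2 : (1 - a) * (1 + b - 4 * a) / ((1 + b)^+2 - 4 * a * b) >= (1 - a) * (15/16 - 5 * a).
  rewrite ler_pdivlMr; last lra.
  rewrite -[leLHS]mulrA; apply: ler_wpM2l; first lra.
  have [h|h] := lerP 0 (15/16 - 5*a).
    nra.
  nra.
nra.
Qed.

(* A subsolution of a backward heat equation: averaging over a small step +-b in x
   gains at least as much as adding 8 b^2 to s. The correction 8 s / (x^2 + s)
   compensates for the concavity of ln far from 0. *)
Definition potential (R : realType) (x s : R) : R := ln (x ^+ 2 + s) / 2 - 8 * s / (x ^+ 2 + s).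

Lemma potential_le (R : realType) (x s : R) : 0 < s -> potential x s <= ln (x ^+ 2 + s) / 2.
Proof.
move=> s0; rewrite /potential gerBl divr_ge0 //; last by rewrite addr_ge0 ?sqr_ge0 ?ltW.
by rewrite mulr_ge0 // ltW.
Qed.

Lemma potential0_ge (R : realType) (s : R) : 1 <= s -> - 8 <= potential 0 s.
Proof.
move=> s1; have s0 : 0 < s by lra.
rewrite /potential expr0n /= add0r mulfK ?gt_eqF //.
by have := ln_ge0 s1; lra.
Qed.

(** Scaling by [w] leaves only the ratios [A] and [B]. The logarithms are estimated to second order
    in [B], while the rational corrections are computed exactly. *)
Lemma potential_step (R : realType) (x b s : R) : 0 < s -> 64 * b ^+ 2 <= s ->
  potential x (s + 8 * b ^+ 2) <= (potential (x + b) s + potential (x - b) s) / 2.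
Proof.
move=> s0 bs.
have x0 := sqr_ge0 x; have b0 := sqr_ge0 b.
set w := x ^+ 2 + s.
have w0 : 0 < w by rewrite /w; lra.
set B := b ^+ 2 / w; set A := x ^+ 2 / w.
have A01 : 0 <= A <= 1.
  by rewrite divr_ge0 ?(ltW w0) //= ler_pdivrMr // /w; lra.
have B01 : 0 <= B <= 1/64.
  by rewrite divr_ge0 ?(ltW w0) //= ler_pdivrMr // /w; lra.
have eA : x ^+ 2 = A * w by rewrite mulfVK ?gt_eqF.
have eB : b ^+ 2 = B * w by rewrite mulfVK ?gt_eqF.
have es : s = (1 - A) * w by rewrite mulrBl -eA /w; ring.
have wp0 : 0 < (x + b) ^+ 2 + s by have := sqr_ge0 (x + b); lra.
have wm0 : 0 < (x - b) ^+ 2 + s by have := sqr_ge0 (x - b); lra.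
have wb0 : 0 < x ^+ 2 + (s + 8 * b ^+ 2) by lra.
set D := (1 + B) ^+ 2 - 4 * A * B.
have D0 : 15 / 16 <= D by rewrite /D; nra.
(* The two shifted arguments multiply to [w ^+ 2 * D], so their logarithms merge into
   [2 ln w + ln D] with [D] close to 1. *)
have prodE : ((x + b) ^+ 2 + s) * ((x - b) ^+ 2 + s) = w ^+ 2 * D.
  have -> : ((x + b) ^+ 2 + s) * ((x - b) ^+ 2 + s)
      = (x ^+ 2 + s + b ^+ 2) ^+ 2 - 4 * x ^+ 2 * b ^+ 2 by ring.
  by rewrite -/w eA eB /D; ring.
have hlog : ln w + ln (x ^+ 2 + s) + (2 * B - 4 * A * B - 9 * B ^+ 2)
     <= ln ((x + b) ^+ 2 + s) + ln ((x - b) ^+ 2 + s).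
  rewrite -[leRHS]lnM ?posrE // prodE lnM ?posrE ?exprn_gt0 //; last lra.
  rewrite lnXn // -/w mulr2n lerD2l.
  have -> : D = 1 + (2 * B - 4 * A * B + B ^+ 2) by rewrite /D; ring.
  apply: le_trans (ln1D_ge _).
    have : (2 * B - 4 * A * B + B ^+ 2) ^+ 2 <= 5 * B ^+ 2.
      have -> : 2 * B - 4 * A * B + B ^+ 2 = B * (2 - 4 * A + B) by ring.
      rewrite exprMn mulrC; apply: ler_wpM2r; first exact: sqr_ge0.
      nra.
    lra.
  by rewrite ler_norml; apply/andP; split; nra.
have hlog2 : ln (x ^+ 2 + (s + 8 * b ^+ 2)) <= ln w + 8 * B.
  have -> : x ^+ 2 + (s + 8 * b ^+ 2) = w * (1 + 8 * B).
    by rewrite eB es /w eA es; ring.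
  rewrite lnM ?posrE //; last lra.
  by rewrite lerD2l; apply: le_ln1Dx; lra.
have hrat : (8 * s / ((x + b) ^+ 2 + s) + 8 * s / ((x - b) ^+ 2 + s)) / 2
    = 8 * ((1 - A) * (1 + B) / D).
  have -> : (8 * s / ((x + b) ^+ 2 + s) + 8 * s / ((x - b) ^+ 2 + s)) / 2
     = 8 * s * (w + b ^+ 2) / (((x + b) ^+ 2 + s) * ((x - b) ^+ 2 + s)).
    by rewrite /w; field; rewrite !gt_eqF.
  by rewrite prodE eB es; field; rewrite !gt_eqF //; lra.
have hrat2 : 8 * (s + 8 * b ^+ 2) / (x ^+ 2 + (s + 8 * b ^+ 2))
    = 8 * ((1 - A + 8 * B) / (1 + 8 * B)).
  rewrite eA eB es; field.
  by apply/andP; split; rewrite gt_eqF //; nra.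
have hI := potential_step_rational A01 B01.
have : 0 <= B * (1/2 - A - 9 / 4 * B - 4 + 8 * (A * 8 / (1 + 8 * B)
     + (1 - A) * (1 + B - 4 * A) / D)) + 0.
  by rewrite addr0 mulr_ge0 //; case/andP: B01.
have -> : B * (1/2 - A - 9 / 4 * B - 4 + 8 * (A * 8 / (1 + 8 * B) + (1 - A) * (1 + B - 4 * A) / D)) + 0
  = (2 * B - 4 * A * B - 9 * B ^+ 2) / 4 - 4 * B + 8 * ((1 - A + 8 * B) / (1 + 8 * B))
   - 8 * ((1 - A) * (1 + B) / D).
  rewrite /D; field.
  by apply/andP; split; rewrite gt_eqF //; rewrite -/D; lra.
rewrite /potential -hrat2 -hrat.
rewrite -/w in hlog.
lra.
Qed.

Lemma sum_flatten_nseq (R : zmodType) (d m : nat) (f : 'I_d -> R) :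
  \sum_(i <- flatten [seq nseq m i | i <- enum 'I_d]) f i = \sum_i f i *+ m.
Proof.
rewrite big_flatten /= big_map big_enum /=.
by apply: eq_bigr => i _; rewrite big_nseq iter_addr_0.
Qed.

Section Walk.
Variables (R : realType) (d n : nat) (a : 'I_n -> 'I_d -> R) (lambda eta v A : R).
Hypotheses (eta_gt0 : 0 < eta) (A_ge0 : 0 <= A).
Hypothesis small_steps : forall j i, 64 * (v * a j i) ^+ 2 <= eta.

Let dot (b x : 'I_d -> R) := \sum_i b i * x i.
Let shift (h : R) (k : 'I_d) (x : 'I_d -> R) i := x i + h *+ (i == k).

(** A lower bound for the expected final objective from [x] when the moves in [s] are still to come:
    each pending move is credited in advance, by [8 * (v * a j i) ^+ 2] in the potential and by a
    factor [expR (2 * (lambda * v) ^+ 2)] in the penalty. *)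
Let gain (s : seq 'I_d) (x : 'I_d -> R) : R :=
  \sum_j potential (dot (a j) x) (eta + \sum_(i <- s) 8 * (v * a j i) ^+ 2)
  - A * \sum_i cosh (lambda * x i)
        * expR (\sum_(k <- s) (2 * (lambda * v) ^+ 2) *+ (i == k)).

Let dot_shift b h k x : dot b (shift h k x) = dot b x + h * b k.
Proof.
rewrite /dot /shift (bigD1 k) //= [in RHS](bigD1 k) //= eqxx mulr1n.
under eq_bigr => i /negPf ne do rewrite ne mulr0n addr0.
ring.
Qed.

(** The potential part is [potential_step]. In the penalty, averaging over both signs multiplies the
    [k]-th term by [cosh (lambda * v)], which the credited factor covers. *)
Let gain_step k s x :
  gain (k :: s) x <= (gain s (shift v k x) + gain s (shift (- v) k x)) / 2.
Proof.
rewrite /gain.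
have hpot : \sum_j potential (dot (a j) x) (eta + \sum_(i <- k :: s) 8 * (v * a j i) ^+ 2)
  <= (\sum_j potential (dot (a j) (shift v k x)) (eta + \sum_(i <- s) 8 * (v * a j i) ^+ 2)
    + \sum_j potential (dot (a j) (shift (- v) k x))
        (eta + \sum_(i <- s) 8 * (v * a j i) ^+ 2)) / 2.
  rewrite -big_split /= mulr_suml; apply: ler_sum => j _.
  rewrite big_cons addrCA [8 * _ + _]addrC !dot_shift mulNr.
  have s0 : 0 <= \sum_(i <- s) 8 * (v * a j i) ^+ 2.
    by apply: sumr_ge0 => i _; rewrite mulr_ge0 ?sqr_ge0.
  apply: potential_step; first exact: ltr_wpDr.
  by apply: le_trans (small_steps j k) _; rewrite lerDl.
have hcosh : (\sum_i cosh (lambda * shift v k x i)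
        * expR (\sum_(l <- s) (2 * (lambda * v) ^+ 2) *+ (i == l))
     + \sum_i cosh (lambda * shift (- v) k x i)
        * expR (\sum_(l <- s) (2 * (lambda * v) ^+ 2) *+ (i == l))) / 2
   <= \sum_i cosh (lambda * x i)
        * expR (\sum_(l <- k :: s) (2 * (lambda * v) ^+ 2) *+ (i == l)).
  rewrite -big_split /= mulr_suml; apply: ler_sum => i _.
  rewrite big_cons expRD mulrA -mulrDl mulrAC ler_wpM2r ?expR_ge0 // /shift.
  case: eqP => _; last first.
    by rewrite !mulr0n !addr0 expR0 mulr1; have := cosh_ge0 (lambda * x i); lra.
  rewrite !mulr1n mulrDr mulrDr mulrN coshD_sub ler_wpM2l ?cosh_ge0 //.
  exact: cosh_le_expR_sqr.
have := ler_wpM2l A_ge0 hcosh; lra.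
Qed.

(** Method of conditional expectations: one of the two signs does at least as well as their
    average. *)
Lemma walk s x : exists y, gain s x <= gain [::] y.
Proof.
elim: s x => [|k s IH] x; first by exists x.
have [y1 h1] := IH (shift v k x); have [y2 h2] := IH (shift (- v) k x).
have h := gain_step k s x.
have [h3|h3] := lerP (gain [::] y1) (gain [::] y2); [exists y2|exists y1]; lra.
Qed.
End Walk.

Lemma good_point (R : realType) (d n : nat) (a : 'I_n -> 'I_d -> R) (lambda eta : R) :
  (0 < d)%N -> (forall j, \sum_i a j i ^+ 2 = 1) -> 0 < eta ->
  exists y : 'I_d -> R,
    n%:R * ((\sum_i cosh (lambda * y i)) / (d%:R * expR (lambda ^+ 2 / 4)) - 9)
    <= \sum_j ln ((\sum_i a j i * y i) ^+ 2 + eta) / 2.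
Proof.
move=> d0 a1 eta0.
(* The number of steps along each axis, large enough that [64 * v ^+ 2 = 8 / m < eta], as small
   steps require. *)
pose m := (Num.bound (8 / eta)).
have m8 : 8 / eta < m%:R.
  by apply: archi_boundP; rewrite divr_ge0 // ltW.
have m0 : 0 < m%:R :> R by apply: le_lt_trans m8; rewrite divr_ge0 // ltW.
(* With [8 * m * v ^+ 2 = 1] the credits of form [j] add up to [\sum_i a j i ^+ 2 = 1], and each
   coordinate's penalty factor becomes [expR (lambda ^+ 2 / 4)]. *)
pose v : R := Num.sqrt (8 * m%:R)^-1.
have v2 : v ^+ 2 = (8 * m%:R)^-1.
  by rewrite sqr_sqrtr // invr_ge0 mulr_ge0 // ltW.
have dR : 0 < d%:R :> R by rewrite ltr0n.
have E0 := expR_gt0 (lambda ^+ 2 / 4).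
set E := expR _ in E0 *.
(* This weight makes the penalty at the origin exactly [n]; as each potential there is at least -8,
   the walk starts from at least [-9 n]. *)
pose A : R := n%:R / (d%:R * E).
have A0 : 0 <= A by rewrite divr_ge0 // mulr_ge0 // ltW.
have small j i : 64 * (v * a j i) ^+ 2 <= eta.
  have a2 : a j i ^+ 2 <= 1.
    rewrite -(a1 j) (bigD1 i) //= lerDl.
    by apply: sumr_ge0 => k _; exact: sqr_ge0.
  have : 8 / m%:R < eta by rewrite ltr_pdivrMr // mulrC -ltr_pdivrMr.
  have -> : 8 / m%:R = 64 * v ^+ 2 by rewrite v2; field; rewrite gt_eqF.
  by rewrite exprMn; have := sqr_ge0 v; nra.
have [y hy] := @walk R d n a lambda eta v A eta0 A0 small
  (flatten [seq nseq m i | i <- enum 'I_d]) (fun=> 0).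
exists y; move: hy.
under [X in X - _ <= _]eq_bigr => j _.
  rewrite sum_flatten_nseq.
  have -> : \sum_i (8 * (v * a j i) ^+ 2) *+ m = 1.
    rewrite -[RHS](a1 j); apply: eq_bigr => i _.
    by rewrite exprMn v2 -[_ *+ m]mulr_natr; field; rewrite gt_eqF.
  have -> : \sum_i a j i * 0 = 0 by rewrite big1 // => i _; rewrite mulr0.
  over.
under [X in _ - A * X <= _]eq_bigr => i _.
  rewrite sum_flatten_nseq (bigD1 i) //= big1 ?addr0; last first.
    by move=> k /negPf; rewrite eq_sym => ->; rewrite mulr0n mul0rn.
  have -> : (2 * (lambda * v) ^+ 2) *+ (i == i) *+ m = lambda ^+ 2 / 4.
    by rewrite eqxx mulr1n exprMn v2 -[_ *+ m]mulr_natr; field; rewrite gt_eqF.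
  have -> : cosh (lambda * 0) = 1 by rewrite /cosh mulr0 oppr0 expR0; field.
  rewrite -/E mul1r; over.
under [X in _ <= _ - A * X]eq_bigr => i _ do rewrite big_nil expR0 mulr1.
rewrite !sumr_const !card_ord.
have hl : - 8 *+ n <= potential 0 (eta + 1) *+ n.
  by apply: ler_wMn2r; apply: potential0_ge; lra.
have -> : A * (E *+ d) = n%:R.
  by rewrite /A -[_ *+ d]mulr_natr; field; rewrite !gt_eqF.
have hu : \sum_j potential (\sum_i a j i * y i) (eta + \sum_(i <- [::]) 8 * (v * a j i) ^+ 2)
    <= \sum_j ln ((\sum_i a j i * y i) ^+ 2 + eta) / 2.
  by apply: ler_sum => j _; rewrite big_nil addr0; exact: potential_le.
rewrite -[_ *+ n]mulr_natr in hl.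
move=> h.
have -> : n%:R * ((\sum_i cosh (lambda * y i)) / (d%:R * E) - 9)
  = A * (\sum_i cosh (lambda * y i)) - 9 * n%:R.
  by rewrite /A; field; rewrite !gt_eqF.
lra.
Qed.

(** * Fekete's lemma *)

Section Fekete.
Variables (R : realType) (c : nat -> R) (M : R).
Hypotheses (c_ge1 : forall n, 1 <= c n)
  (c_supermul : forall m n, c m * c n <= c (m + n)%N)
  (c_le : forall n, c n <= M ^+ n) (M_ge0 : 0 <= M).

Let u (n : nat) : R := c n.+1 `^ (n.+1%:R)^-1.

Let u_le n : u n <= M.
Proof.
rewrite -[leRHS](expr_powRVn n M_ge0) ge0_ler_powR // ?nnegrE ?invr_ge0 ?exprn_ge0 //.
exact: le_trans (c_ge1 _).
Qed.

Let c_ge_pow k q : c k ^+ q <= c (q * k)%N.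
Proof.
elim: q => [|q IH]; first by rewrite expr0.
rewrite exprS mulSn; apply: le_trans (c_supermul _ _).
by rewrite ler_wpM2l // (le_trans ler01).
Qed.

Let c_nd m n : c m <= c (m + n)%N.
Proof.
apply: le_trans (c_supermul _ _); rewrite ler_peMr //.
exact: le_trans (c_ge1 _).
Qed.

Let has_sup_u : has_sup (range u).
Proof.
split; first by exists (u 0%N), 0%N.
by exists M => _ [n _ <-].
Qed.

(** Take [u k] within [e / 2] of the supremum and divide [n.+1] by [k.+1]. Supermultiplicativity
    handles the quotient and monotonicity of [c] discards the remainder, so [u n] is at least [b] to
    the power [1 - k.+1 / n.+1]. *)
Lemma fekete_cvg : u @ \oo --> sup (range u).
Proof.
apply/cvgrPdist_le => e e0.
have e2 : 0 < e / 2 by rewrite divr_gt0.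
have [_ [k _ <-] hk] := sup_adherent e2 has_sup_u.
set b := u k in hk.
have c0 n : 0 <= c n by exact: le_trans (c_ge1 _).
have b1 : 1 <= b.
  have <- : 1 `^ (k.+1%:R)^-1 = 1 :> R by rewrite powR1.
  by rewrite ge0_ler_powR ?nnegrE.
have b0 : 0 < b by exact: lt_le_trans b1.
have lb0 : 0 <= ln b by exact: ln_ge0.
have X0 : 0 <= 2 * b * k.+1%:R * ln b / e.
  by rewrite divr_ge0 ?mulr_ge0 // ltW.
near=> n.
rewrite ger0_norm; last first.
  by rewrite subr_ge0; apply: ub_le_sup; [exact: (proj2 has_sup_u)|exists n].
suff : b - e / 2 <= u n by lra.
have n0 : 0 < n.+1%:R :> R by rewrite ltr0n.
have h1 : expR ((n.+1%:R - k.+1%:R) * ln b) <= c n.+1.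
  have q1 : n.+1%:R - k.+1%:R <= (n.+1 %/ k.+1 * k.+1)%:R :> R.
    rewrite lerBlDr -natrD ler_nat {1}(divn_eq n.+1 k.+1) leq_add2l ltnW //.
    by rewrite ltn_mod.
  have h2 : b ^+ (n.+1 %/ k.+1 * k.+1) <= c n.+1.
    rewrite mulnC exprM /b powRVn_expr //.
    apply: le_trans (c_ge_pow _ _) _.
    by rewrite [in leRHS](divn_eq n.+1 k.+1).
  apply: le_trans h2; rewrite -[in leRHS](lnK (b0 : b \is Num.pos)) -expRM_natl.
  by rewrite ler_expR ler_wpM2r.
have h2 : expR ((1 - k.+1%:R / n.+1%:R) * ln b) <= u n.
  have -> : (1 - k.+1%:R / n.+1%:R) * ln b = ((n.+1%:R - k.+1%:R) * ln b) * n.+1%:R^-1.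
    by field; rewrite gt_eqF.
  by rewrite expRM ge0_ler_powR // nnegrE ?expR_ge0.
apply: le_trans h2.
rewrite mulrBl mul1r expRD lnK ?posrE //.
have : b * (1 + - (k.+1%:R / n.+1%:R * ln b)) <= b * expR (- (k.+1%:R / n.+1%:R * ln b)).
  by rewrite ler_pM2l // expR_ge1Dx.
apply: le_trans.
rewrite mulrDr mulr1 lerD2l mulrN lerN2.
(* The loss is [e / 2] times a ratio that is at most 1 once [n.+1] passes
   [2 * b * k.+1%:R * ln b / e]. *)
have -> : b * (k.+1%:R / n.+1%:R * ln b) = (2 * b * k.+1%:R * ln b / e) / n.+1%:R * (e / 2).
  by field; rewrite !gt_eqF.
rewrite ler_piMl // ?(ltW e2) // ler_pdivrMr // mul1r.
apply: le_trans (_ : (Num.bound (2 * b * k.+1%:R * ln b / e))%:R <= _).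
  by apply/ltW/archi_boundP.
rewrite ler_nat ltnW // ltnS.
by near: n; exists (Num.bound (2 * b * k.+1%:R * ln b / e)).
Unshelve. all: by end_near.
Qed.

Lemma fekete_lim_le : lim (u @ \oo) <= M.
Proof.
rewrite (cvg_lim _ fekete_cvg) //.
by apply: ge_sup; [exact: (proj1 has_sup_u)|move=> _ [n _ <-]].
Qed.

Lemma fekete_lim_ge k x : 0 <= x -> x ^+ k.+1 <= c k.+1 -> x <= lim (u @ \oo).
Proof.
move=> x0 xk; rewrite (cvg_lim _ fekete_cvg) //.
apply: le_trans (_ : u k <= _); last first.
  by apply: ub_le_sup; [exact: (proj2 has_sup_u)|exists k].
rewrite -[leLHS](expr_powRVn k x0) ge0_ler_powR // ?nnegrE ?invr_ge0 ?exprn_ge0 //.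
exact: le_trans (c_ge1 _).
Qed.
End Fekete.

(** * Polarization constants *)

(* [iota] embeds the reals; [u] and [v] are the real and imaginary parts
   ([id] and [0] when K = R). *)
Record real_or_complex (R : realType) (K : comNzRingType) (mK : K -> R)
    (iota : {rmorphism R -> K}) (u v : K -> R) : Prop := RealOrComplex {
  modulus_ge0 : forall z, 0 <= mK z;
  modulusM : forall z w, mK (z * w) = mK z * mK w;
  modulus_real : forall r, mK (iota r) = `|r|;
  modulusD : forall z w, mK (z + w) <= mK z + mK w;
  modulus_sqr : forall z, mK z ^+ 2 = u z ^+ 2 + v z ^+ 2;
  realpartD : {morph u : z w / z + w};
  imagpartD : {morph v : z w / z + w};
  realpartZ : forall r z, u (iota r * z) = r * u z;
  imagpartZ : forall r z, v (iota r * z) = r * v z }.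

(** Treats [lpnorm] and [linfnorm] together. Homogeneity allows rescaling to the unit sphere, and
    domination of the coordinates bounds every functional there. *)
Record gauge (R : realType) (K : comNzRingType) (mK : K -> R)
    (iota : R -> K) (d : nat) (N : 'rV[K]_d -> R) : Prop := Gauge {
  gaugeZ : forall r (x : 'rV[K]_d), N (iota r *: x) = `|r| * N x;
  coord_le_gauge : forall (x : 'rV[K]_d) i, mK (x 0 i) <= N x }.

Section Polarization.
Variables (R : realType) (K : comNzRingType) (mK : K -> R)
  (iota : {rmorphism R -> K}) (u v : K -> R).
Hypothesis KP : real_or_complex mK iota u v.

Lemma modulus0 : mK 0 = 0.
Proof. by rewrite -(rmorph0 iota) (modulus_real KP) normr0. Qed.

Lemma modulus1 : mK 1 = 1.
Proof. by rewrite -(rmorph1 iota) (modulus_real KP) normr1. Qed.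

Lemma modulus_prod (I : finType) (F : I -> K) : mK (\prod_i F i) = \prod_i mK (F i).
Proof. exact: (big_morph mK (modulusM KP) modulus1). Qed.

Lemma modulus_sum (I : finType) (F : I -> K) : mK (\sum_i F i) <= \sum_i mK (F i).
Proof.
elim/big_ind2: _ => [|z x w y h1 h2|//]; first by rewrite modulus0.
exact: le_trans (modulusD KP _ _) (lerD h1 h2).
Qed.

Section Functionals.
Variable d : nat.
Implicit Types (f : 'rV[K]_d -> K) (x : 'rV[K]_d).

Lemma functional0 f : is_linear_functional f -> f 0 = 0.
Proof.
move=> lf; have := lf 1 0 0; rewrite scaler0 addr0 mul1r => h.
by apply: (@addrI _ (f 0)); rewrite addr0 -h.
Qed.

Lemma functionalZ f c x : is_linear_functional f -> f (c *: x) = c * f x.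
Proof. by move=> lf; have := lf c x 0; rewrite (functional0 lf) !addr0. Qed.

Lemma functionalE f x : is_linear_functional f ->
  f x = \sum_i x 0 i * f (delta_mx 0 i).
Proof.
move=> lf; rewrite {1}(row_sum_delta x).
have fD : {morph f : y z / y + z}.
  by move=> y z; have := lf 1 y z; rewrite scale1r mul1r.
rewrite (big_morph f fD (functional0 lf)).
by apply: eq_bigr => i _; rewrite functionalZ.
Qed.

Variable N : 'rV[K]_d -> R.
Hypothesis NP : gauge mK iota N.
Hypothesis d_gt0 : (0 < d)%N.

Lemma gauge_ge0 x : 0 <= N x.
Proof. exact: le_trans (modulus_ge0 KP _) (coord_le_gauge NP x (Ordinal d_gt0)). Qed.

Lemma gauge_normalize x : 0 < N x -> N (iota (N x)^-1 *: x) = 1.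
Proof. by move=> x0; rewrite (gaugeZ NP) ger0_norm ?invr_ge0 ?gauge_ge0 // mulVf ?gt_eqF. Qed.

Lemma sphere_nonempty : exists x, N x = 1.
Proof.
have h : 0 < N (const_mx 1).
  apply: lt_le_trans (coord_le_gauge NP _ (Ordinal d_gt0)).
  by rewrite mxE modulus1.
by eexists; exact: gauge_normalize h.
Qed.

(** [sup] of an unbounded set is a default value, so using [supnorm] as an upper bound requires
    this. *)
Definition bounded_on_sphere (P : 'rV[K]_d -> K) :=
  exists M, forall x, N x = 1 -> mK (P x) <= M.

Lemma le_supnorm (P : 'rV[K]_d -> K) x : bounded_on_sphere P -> N x = 1 ->
  mK (P x) <= supnorm mK N P.
Proof.
move=> [M hM] x1; apply: ub_le_sup; last by exists x.
by exists M => _ [y /= /hM ? <-].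
Qed.

Lemma supnorm_le (P : 'rV[K]_d -> K) M : (forall x, N x = 1 -> mK (P x) <= M) ->
  supnorm mK N P <= M.
Proof.
move=> hM; apply: ge_sup; last by move=> _ [y /= /hM ? <-].
by have [x x1] := sphere_nonempty; exists (mK (P x)), x.
Qed.

Lemma supnorm_ge0 (P : 'rV[K]_d -> K) : bounded_on_sphere P -> 0 <= supnorm mK N P.
Proof.
move=> bP; have [x x1] := sphere_nonempty.
exact: le_trans (modulus_ge0 KP _) (le_supnorm bP x1).
Qed.

Lemma functional_bounded f : is_linear_functional f -> bounded_on_sphere f.
Proof.
move=> lf; exists (\sum_i mK (f (delta_mx 0 i))) => x x1.
rewrite functionalE //; apply: le_trans (modulus_sum _) _; apply: ler_sum => i _.
by rewrite (modulusM KP) ler_piMl ?(modulus_ge0 KP) // -x1 (coord_le_gauge NP).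
Qed.

Lemma prod_functional_le (I : finType) (psi : I -> 'rV[K]_d -> K) x :
  (forall i, is_linear_functional (psi i)) -> N x = 1 ->
  mK (\prod_i psi i x) <= \prod_i supnorm mK N (psi i).
Proof.
move=> lpsi x1; rewrite modulus_prod; apply: ler_prod => i _.
by rewrite (modulus_ge0 KP) le_supnorm //; exact: functional_bounded.
Qed.

Lemma prod_functional_bounded (I : finType) (psi : I -> 'rV[K]_d -> K) :
  (forall i, is_linear_functional (psi i)) ->
  bounded_on_sphere (fun x => \prod_i psi i x).
Proof. by move=> lpsi; eexists => x; exact: prod_functional_le. Qed.

Lemma prod_le_supnorm (I : finType) (psi : I -> 'rV[K]_d -> K) x :
  (forall i, is_linear_functional (psi i)) -> 0 < N x ->
  \prod_i mK (psi i x) <= supnorm mK N (fun x => \prod_i psi i x) * N x ^+ #|I|.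
Proof.
move=> lpsi x0; rewrite -ler_pdivrMr ?exprn_gt0 //.
have := le_supnorm (prod_functional_bounded lpsi) (gauge_normalize x0).
apply: le_trans; rewrite modulus_prod.
under [leRHS]eq_bigr => i _ do
  rewrite functionalZ // (modulusM KP) (modulus_real KP) ger0_norm ?invr_ge0 ?gauge_ge0 //.
by rewrite big_split /= prodr_const exprVn mulrC.
Qed.

Lemma functional_le_supnorm f x : is_linear_functional f -> 0 < N x ->
  mK (f x) <= supnorm mK N f * N x.
Proof.
move=> lf x0; rewrite -ler_pdivrMr //.
have := le_supnorm (functional_bounded lf) (gauge_normalize x0).
by rewrite functionalZ // (modulusM KP) (modulus_real KP) ger0_norm ?invr_ge0 ?gauge_ge0 // mulrC.
Qed.

Lemma coord_functional (i : 'I_d) : is_linear_functional (fun x : 'rV[K]_d => x 0 i).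
Proof. by move=> c x y; rewrite !mxE. Qed.

Lemma cn_le n C : 0 <= C ->
  (forall psi : 'I_n -> 'rV[K]_d -> K, (forall i, is_linear_functional (psi i)) ->
     \prod_i supnorm mK N (psi i) <= C * supnorm mK N (fun x => \prod_i psi i x)) ->
  cn mK N n <= C.
Proof.
move=> C0 hC; apply: ge_inf; last by split.
by exists 0 => z [].
Qed.

(* [polar] rules out the junk value [inf set0 = 0] of [cn] and makes the sequence
   of n-th roots bounded. *)
Variable M : R.
Hypothesis M_ge0 : 0 <= M.
Hypothesis polar : forall n (psi : 'I_n -> 'rV[K]_d -> K),
  (forall i, is_linear_functional (psi i)) ->
  \prod_i supnorm mK N (psi i) <= M ^+ n * supnorm mK N (fun x => \prod_i psi i x).

Lemma cn_ge0 n : 0 <= cn mK N n.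
Proof.
apply: lb_le_inf; last by move=> z [].
by exists (M ^+ n); split; [exact: exprn_ge0|exact: polar].
Qed.

(** The infimum is itself admissible: divide by the norm of the product. If that norm is 0, [polar]
    makes the left side vanish as well. *)
Lemma cn_spec n (psi : 'I_n -> 'rV[K]_d -> K) :
  (forall i, is_linear_functional (psi i)) ->
  \prod_i supnorm mK N (psi i) <= cn mK N n * supnorm mK N (fun x => \prod_i psi i x).
Proof.
move=> lpsi; have S0 := supnorm_ge0 (prod_functional_bounded lpsi).
move: S0; rewrite le_eqVlt => /predU1P[S0|S0].
  by have := polar lpsi; rewrite -S0 !mulr0.
rewrite -ler_pdivrMr //; apply: lb_le_inf.
  by exists (M ^+ n); split; [exact: exprn_ge0|exact: polar].
by move=> C [C0 hC]; rewrite ler_pdivrMr //; exact: hC.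
Qed.

(** Tested on [n] copies of one coordinate: the norm of a product never exceeds the product of the
    norms, which is positive here. *)
Lemma cn_ge1 n : 1 <= cn mK N n.
Proof.
pose psi (_ : 'I_n) (x : 'rV[K]_d) := x 0 (Ordinal d_gt0).
have lpsi i : is_linear_functional (psi i) by exact: coord_functional.
have P0 : 0 < \prod_i supnorm mK N (psi i).
  apply: prodr_gt0 => i _.
  have x0 : 0 < N (const_mx 1).
    apply: lt_le_trans (coord_le_gauge NP _ (Ordinal d_gt0)).
    by rewrite mxE modulus1.
  rewrite -(pmulr_lgt0 _ x0); apply: lt_le_trans (functional_le_supnorm (lpsi i) x0).
  by rewrite /psi mxE modulus1.
rewrite -(ler_pM2r P0) mul1r; apply: le_trans (cn_spec lpsi) _.
rewrite ler_wpM2l ?cn_ge0 //; apply: supnorm_le => x; exact: prod_functional_le.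
Qed.

(** Dividing out one constant at a time reduces the claim to [cn_spec] for the concatenation [chi]
    of two arbitrary families. The norm of its product is at most the product of the two norms. *)
Lemma cn_supermul m n : cn mK N m * cn mK N n <= cn mK N (m + n).
Proof.
have cn0 k : 0 < cn mK N k by apply: lt_le_trans (cn_ge1 k).
rewrite -ler_pdivlMr //; apply: cn_le => [|psi lpsi]; first by rewrite divr_ge0 ?cn_ge0.
have P0 : 0 <= \prod_i supnorm mK N (psi i).
  by apply: prodr_ge0 => i _; exact/supnorm_ge0/functional_bounded.
have S0 := supnorm_ge0 (prod_functional_bounded lpsi).
rewrite mulrAC ler_pdivlMr // mulrC.
move: P0; rewrite le_eqVlt => /predU1P[<-|P0]; first by rewrite mulr0 mulr_ge0 ?cn_ge0.
rewrite -ler_pdivlMr //; apply: cn_le => [|phi lphi].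
  by rewrite divr_ge0 ?mulr_ge0 ?cn_ge0 // ltW.
rewrite mulrAC ler_pdivlMr // mulrC.
pose chi (i : 'I_(m + n)) := match fintype.split i with inl j => psi j | inr k => phi k end.
have lchi i : is_linear_functional (chi i) by rewrite /chi; case: fintype.split.
have chil i : chi (lshift n i) = psi i by rewrite /chi (unsplitK (inl i)).
have chir i : chi (rshift m i) = phi i by rewrite /chi (unsplitK (inr i)).
have := cn_spec lchi; rewrite big_split_ord /=.
under eq_bigr do rewrite chil.
under [X in _ * X <= _ -> _]eq_bigr do rewrite chir.
move/le_trans; apply; rewrite -mulrA ler_wpM2l ?cn_ge0 //.
apply: supnorm_le => x x1; rewrite big_split_ord (modulusM KP) /=.
under eq_bigr do rewrite chil.
under [X in _ * mK X <= _]eq_bigr do rewrite chir.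
by apply: ler_pM; rewrite ?(modulus_ge0 KP) //; apply: le_supnorm => //;
  exact: prod_functional_bounded.
Qed.

Let cn_le_pow n : cn mK N n <= M ^+ n.
Proof. by apply: cn_le => [|psi lpsi]; [exact: exprn_ge0|exact: polar]. Qed.

Lemma cconst_le : cconst mK N <= M.
Proof. exact: fekete_lim_le cn_ge1 cn_supermul cn_le_pow M_ge0. Qed.

(** A single family is enough because the limit is a supremum. Any finite index type is allowed, so
    that sign patterns can serve as indices. *)
Lemma cconst_ge (t : R) (I : finType) (psi : I -> 'rV[K]_d -> K) : (0 < #|I|)%N ->
  (forall i, is_linear_functional (psi i)) -> 0 <= t ->
  0 < supnorm mK N (fun y => \prod_i psi i y) ->
  t ^+ #|I| * supnorm mK N (fun y => \prod_i psi i y) <= \prod_i supnorm mK N (psi i) ->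
  t <= cconst mK N.
Proof.
move=> I0 lpsi t0 S0 h.
have reindexI (T : comNzRingType) (F : I -> T) :
    \prod_i F i = \prod_(k < #|I|) F (enum_val k).
  by rewrite (reindex_onto enum_val enum_rank) => [|i _]; rewrite ?enum_rankK //;
     apply: eq_bigl => k; rewrite enum_valK eqxx.
have h2 : t ^+ #|I| <= cn mK N #|I|.
  rewrite -(ler_pM2r S0); apply: le_trans h _; rewrite reindexI.
  have -> : (fun y => \prod_i psi i y) = fun y => \prod_(k < #|I|) psi (enum_val k) y.
    by apply/funext => y; rewrite reindexI.
  by apply: cn_spec => k.
case: #|I| I0 h2 => // k _ h2.
exact: (fekete_lim_ge cn_ge1 cn_supermul cn_le_pow M_ge0 t0 h2).
Qed.

End Functionals.
End Polarization.

(** * Upper bound from a good real point *)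

Section UpperBound.
Variables (R : realType) (K : comNzRingType) (mK : K -> R)
  (iota : {rmorphism R -> K}) (u v : K -> R).
Hypothesis KP : real_or_complex mK iota u v.
Variables (d : nat) (N : 'rV[K]_d -> R).
Hypothesis NP : gauge mK iota N.
Hypothesis d_gt0 : (0 < d)%N.
Variables (D B lambda : R).
Hypotheses (D_gt0 : 0 < D) (B_gt0 : 0 < B).
Hypothesis euclid_le : forall x : 'rV[K]_d, \sum_i mK (x 0 i) ^+ 2 <= D ^+ 2 * N x ^+ 2.
Hypothesis gauge_le_cosh : forall y : 'I_d -> R, N (\row_i iota (y i)) <=
  B * expR ((\sum_i cosh (lambda * y i)) / (d%:R * expR (lambda ^+ 2 / 4))).

(** Cauchy-Schwarz in the form [2 D s x f <= s^2 x^2 + D^2 f^2], summed over the coordinates;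
    [s = 0] is separate because [2 D s] is cancelled. *)
Let functional_supnorm_le (f : 'rV[K]_d -> K) (s : R) : is_linear_functional f ->
  0 <= s -> \sum_i mK (f (delta_mx 0 i)) ^+ 2 <= s ^+ 2 -> supnorm mK N f <= D * s.
Proof.
move=> lf s0 hs; apply: (supnorm_le KP NP) => // x x1.
rewrite (functionalE _ lf); apply: le_trans (modulus_sum KP _) _.
have hx := euclid_le x; rewrite x1 expr1n mulr1 in hx.
have [s_gt0|s_le0] := ltP 0 s; last first.
  have s00 : s = 0 by apply: le_anti; rewrite s0 s_le0.
  rewrite s00 expr0n /= in hs; rewrite s00 mulr0.
  rewrite big1 // => i _; rewrite (modulusM KP).
  suff -> : mK (f (delta_mx 0 i)) = 0 by rewrite mulr0.
  apply/eqP; rewrite -sqrf_eq0; apply/eqP/le_anti; rewrite sqr_ge0 andbT.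
  apply: le_trans hs; rewrite [leRHS](bigD1 i) //= lerDl.
  by apply: sumr_ge0 => k _; exact: sqr_ge0.
have Ds : 0 < 2 * (D * s) by rewrite !mulr_gt0.
rewrite -(ler_pM2l Ds).
apply: le_trans (_ : \sum_i (s ^+ 2 * mK (x 0 i) ^+ 2 + D ^+ 2 * mK (f (delta_mx 0 i)) ^+ 2) <= _).
  rewrite mulr_sumr; apply: ler_sum => i _; rewrite (modulusM KP).
  have := sqr_ge0 (s * mK (x 0 i) - D * mK (f (delta_mx 0 i))); nra.
rewrite big_split /= -!mulr_sumr.
have h1 := ler_wpM2l (sqr_ge0 s) hx.
have h2 := ler_wpM2l (sqr_ge0 D) hs.
apply: le_trans (lerD h1 h2) _; lra.
Qed.

(** [bt.2] is the Euclidean norm of the [w]-parts of the coefficients and [bt.1] their unit vector;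
    at real points the modulus of [f] dominates its [w]-part. The 4 becomes the 2 in [2 * D] after a
    square root. *)
Let real_minorant_of (w : K -> R) (f : 'rV[K]_d -> K) : is_linear_functional f ->
  {morph w : y z / y + z} -> (forall r z, w (iota r * z) = r * w z) ->
  (forall z, w z ^+ 2 <= mK z ^+ 2) ->
  (\sum_i mK (f (delta_mx 0 i)) ^+ 2 <= 4 * \sum_i w (f (delta_mx 0 i)) ^+ 2) ->
  exists bt : ('I_d -> R) * R, [/\ \sum_i bt.1 i ^+ 2 = 1, 0 <= bt.2,
    supnorm mK N f <= 2 * D * bt.2 &
    forall y, bt.2 * `|\sum_i bt.1 i * y i| <= mK (f (\row_i iota (y i)))].
Proof.
move=> lf wD wZ w_le hw.
set S := \sum_i w _ ^+ 2 in hw.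
have S0 : 0 <= S by apply: sumr_ge0 => i _; exact: sqr_ge0.
set t := Num.sqrt S.
have t0 : 0 <= t by exact: sqrtr_ge0.
have t2 : t ^+ 2 = S by exact: sqr_sqrtr.
have sup_le : supnorm mK N f <= 2 * D * t.
  rewrite -mulrA mulrCA; apply: functional_supnorm_le => //; first by rewrite mulr_ge0.
  by rewrite exprMn t2; lra.
have [t_gt0|t_le0] := ltP 0 t; last first.
  have t00 : t = 0 by apply: le_anti; rewrite t0 t_le0.
  (* All [w]-parts vanish: any unit vector will do, with weight 0. *)
  exists ((fun i => (i == Ordinal d_gt0)%:R), 0); rewrite t00 in sup_le; split => //=.
    rewrite (bigD1 (Ordinal d_gt0)) // eqxx expr1n big1 => [|i /negPf ->]; last by rewrite expr0n.
    exact: addr0.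
  by move=> y; rewrite mul0r (modulus_ge0 KP).
exists ((fun i => w (f (delta_mx 0 i)) / t), t); split => //=.
  under eq_bigr do rewrite exprMn.
  by rewrite -mulr_suml -/S -t2 -exprMn divff ?expr1n // gt_eqF.
move=> y.
have w0 : w 0 = 0 by have := wZ 0 0; rewrite mulr0 mul0r.
have -> : t * `|\sum_i w (f (delta_mx 0 i)) / t * y i| = `|w (f (\row_i iota (y i)))|.
  rewrite -{1}[t]ger0_norm // -normrM mulr_sumr (functionalE _ lf).
  rewrite (big_morph w wD w0); congr `|_|; apply: eq_bigr => i _.
  by rewrite mxE wZ; field; rewrite gt_eqF.
rewrite -(@ler_pXn2r _ 2) ?nnegrE ?(modulus_ge0 KP) //.
by rewrite real_normK ?num_real.
Qed.

Let real_minorant (f : 'rV[K]_d -> K) : is_linear_functional f ->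
  exists bt : ('I_d -> R) * R, [/\ \sum_i bt.1 i ^+ 2 = 1, 0 <= bt.2,
    supnorm mK N f <= 2 * D * bt.2 &
    forall y, bt.2 * `|\sum_i bt.1 i * y i| <= mK (f (\row_i iota (y i)))].
Proof.
move=> lf.
have hE : \sum_i mK (f (delta_mx 0 i)) ^+ 2
    = \sum_i u (f (delta_mx 0 i)) ^+ 2 + \sum_i v (f (delta_mx 0 i)) ^+ 2.
  by rewrite -big_split; apply: eq_bigr => i _; exact: (modulus_sqr KP).
have U0 : 0 <= \sum_i u (f (delta_mx 0 i)) ^+ 2 by apply: sumr_ge0 => i _; exact: sqr_ge0.
have V0 : 0 <= \sum_i v (f (delta_mx 0 i)) ^+ 2 by apply: sumr_ge0 => i _; exact: sqr_ge0.
move: hE U0 V0; set U := \sum_i u _ ^+ 2; set V := \sum_i v _ ^+ 2 => hE U0 V0.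
have [UV|/ltW UV] := lerP V U.
- apply: (real_minorant_of lf (realpartD KP) (realpartZ KP)).
    by move=> z; rewrite (modulus_sqr KP) lerDl sqr_ge0.
  by rewrite hE -/U; lra.
- apply: (real_minorant_of lf (imagpartD KP) (imagpartZ KP)).
    by move=> z; rewrite (modulus_sqr KP) lerDr sqr_ge0.
  by rewrite hE -/V; lra.
Qed.

(** At the point of [good_point] the normalised real forms have product at least about
    [expR (T - 9) ^+ n], while [N X <= B * expR T]. Dividing by [N X ^+ n] cancels [T]; the factor
    [2 * D] comes from [real_minorant]. *)
Lemma polarization_bound n (psi : 'I_n -> 'rV[K]_d -> K) :
  (forall i, is_linear_functional (psi i)) ->
  \prod_i supnorm mK N (psi i)
    <= (2 * expR 9 * D * B) ^+ n * supnorm mK N (fun x => \prod_i psi i x).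
Proof.
move=> lpsi; case: n psi lpsi => [|n] psi lpsi.
  have [x x1] := sphere_nonempty KP NP d_gt0.
  have := le_supnorm (prod_functional_bounded KP NP lpsi) x1.
  by rewrite !big_ord0 expr0 mul1r (modulus1 KP).
set S := supnorm mK N (fun x => \prod_i psi i x).
have [bt hbt] := choice (fun j => real_minorant (lpsi j)).
pose b j := (bt j).1; pose tau j := (bt j).2.
have tau0 j : 0 <= tau j by have [] := hbt j.
pose Th := \prod_j tau j.
have Th0 : 0 <= Th by exact: prodr_ge0.
have hsup : \prod_i supnorm mK N (psi i) <= (2 * D) ^+ n.+1 * Th.
  rewrite -[n.+1 in leRHS]card_ord -prodr_const -big_split /=.
  apply: ler_prod => j _; have [_ _ h _] := hbt j; rewrite h andbT.
  exact: (supnorm_ge0 KP NP d_gt0 (functional_bounded KP NP (lpsi j))).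
apply: le_trans hsup _.
have -> : (2 * expR 9 * D * B) ^+ n.+1 * S = (2 * D) ^+ n.+1 * ((expR 9 * B) ^+ n.+1 * S).
  by rewrite mulrA -exprMn; congr (_ ^+ _ * _); ring.
rewrite ler_pM2l ?exprn_gt0 ?mulr_gt0 //.
have c0 := expR_gt0 (- 9 : R); set c := expR (- 9) in c0.
have e9 : expR 9 = c^-1 by rewrite /c expRN invrK.
suff : Th * (c / B) ^+ n.+1 <= S.
  have -> : expR 9 * B = (c / B)^-1 by rewrite e9 invf_div mulrC.
  by move=> h; rewrite exprVn [leRHS]mulrC ler_pdivlMr // exprn_gt0 // divr_gt0.
have dR : 0 < d%:R :> R by rewrite ltr0n.
have [C C0 hC] := prod_perturb n.+1 (ltW dR).
apply/ler_addgt0Pr => e e0.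
have CT0 : 0 < C * Th + 1 by rewrite ltr_wpDl // mulr_ge0.
(* Chosen so that the final error [Th * (C * del)] is at most [e]. *)
pose del := Num.min 1 (e / (C * Th + 1)).
have del0 : 0 < del by rewrite lt_min ltr01 divr_gt0.
have del1 : del <= 1 by rewrite ge_min lexx.
have dele : Th * (C * del) <= e.
  have h : del <= e / (C * Th + 1) by rewrite ge_min lexx orbT.
  rewrite ler_pdivlMr // in h.
  apply: le_trans h; have -> : Th * (C * del) = del * (C * Th) by ring.
  by rewrite mulrDr mulr1 lerDl ltW.
(* The first bound keeps [N X] away from 0 (see [Nlow]); with that, the second gives
   [eps / N X <= del]. *)
pose eps := Num.min (c / 2) (del * c / (2 * d%:R)).
have eps0 : 0 < eps.
  by rewrite lt_min !divr_gt0 ?mulr_gt0.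
have epsc : eps <= c / 2 by rewrite ge_min lexx.
have epsd : eps <= del * c / (2 * d%:R) by rewrite ge_min lexx orbT.
have b1 j : \sum_i b j i ^+ 2 = 1 by have [] := hbt j.
have [y] := good_point lambda d_gt0 b1 (exprn_gt0 2 eps0).
set T := _ / _ => hy.
set X : 'rV[K]_d := \row_i iota (y i).
have T0 : 0 <= T.
  by rewrite divr_ge0 ?mulr_ge0 ?expR_ge0 ?sumr_ge0 // => i _; exact: cosh_ge0.
pose q j := `|\sum_i b j i * y i|.
have q0 j : 0 <= q j by exact: normr_ge0.
(* Exponentiate [hy], using that [q j ^+ 2 + eps ^+ 2] is at most [(q j + eps) ^+ 2]. *)
have hprod : (c * expR T) ^+ n.+1 <= \prod_j (q j + eps).
  rewrite /c -expRD -expRM_natl [- 9 + T]addrC.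
  have -> : \prod_j (q j + eps) = expR (\sum_j ln (q j + eps)).
    rewrite expR_sum; apply: eq_bigr => j _.
    by rewrite lnK // posrE ltr_wpDl.
  rewrite ler_expR; apply: le_trans hy _; apply: ler_sum => j _.
  have qe : 0 < q j + eps by rewrite ltr_wpDl.
  rewrite ler_pdivrMr // mulr_natr -lnXn // ler_ln ?posrE ?exprn_gt0 //.
    have -> : (\sum_i b j i * y i) ^+ 2 = q j ^+ 2 by rewrite real_normK ?num_real.
    by rewrite sqrrD addrAC lerDl mulrn_wge0 // mulr_ge0 // ltW.
  by rewrite ltr_wpDl ?sqr_ge0 ?exprn_gt0.
have NX : N X <= B * expR T by exact: gauge_le_cosh.
have NX0 : 0 <= N X by exact: (gauge_ge0 KP NP).
have qN j : q j <= d%:R * N X.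
  apply: le_trans (ler_norm_sum _ _ _) _.
  rewrite -[d in leRHS]card_ord mulr_natl -sumr_const; apply: ler_sum => i _.
  rewrite normrM; have bi1 : `|b j i| <= 1.
    rewrite -(@ler_pXn2r _ 2) ?nnegrE // expr1n real_normK ?num_real //.
    rewrite -(b1 j) (bigD1 i) //= lerDl.
    by apply: sumr_ge0 => k _; exact: sqr_ge0.
  apply: le_trans (ler_wpM2r (normr_ge0 _) bi1) _; rewrite mul1r.
  have := coord_le_gauge NP X i; by rewrite mxE (modulus_real KP).
(* Otherwise every factor [q j + eps] would be below [c], against [hprod] and [T >= 0]. *)
have Nlow : c / (2 * d%:R) <= N X.
  rewrite leNgt; apply/negP => hN.
  have : d%:R * N X + eps < c.
    have : d%:R * N X < c / 2.
      rewrite mulrC -ltr_pdivlMr //.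
      suff -> : c / 2 / d%:R = c / (2 * d%:R) by [].
      by field; rewrite gt_eqF.
    lra.
  have h0 : 0 <= d%:R * N X + eps by rewrite addr_ge0 ?mulr_ge0 // ltW.
  move=> h; have := ltrXn2r n.+1 h0 h; rewrite /= => h2.
  have : c ^+ n.+1 <= (d%:R * N X + eps) ^+ n.+1.
    apply: le_trans (_ : (c * expR T) ^+ n.+1 <= _).
      rewrite lerXn2r ?nnegrE ?mulr_ge0 ?expR_ge0 ?(ltW c0) //.
      rewrite ler_peMr ?(ltW c0) //; apply: le_trans (expR_ge1Dx T); lra.
    apply: le_trans hprod _.
    rewrite -[n.+1 in leRHS]card_ord -prodr_const; apply: ler_prod => j _.
    by rewrite addr_ge0 ?(ltW eps0) //= lerD2r.
  by rewrite leNgt h2.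
have NXp : 0 < N X by apply: lt_le_trans Nlow; rewrite divr_gt0 // mulr_gt0.
have hr j : 0 <= q j / N X <= d%:R.
  by rewrite divr_ge0 //= ler_pdivrMr.
have eN : eps / N X <= del.
  rewrite ler_pdivrMr //; apply: le_trans epsd _.
  by rewrite -mulrA ler_pM2l.
have eN01 : 0 <= eps / N X <= 1.
  by rewrite divr_ge0 ?(ltW eps0) //=; exact: le_trans eN del1.
have := hC _ _ hr eN01.
have -> : \prod_j (q j / N X + eps / N X) = (\prod_j (q j + eps)) / N X ^+ n.+1.
  under eq_bigr do rewrite -mulrDl.
  by rewrite big_split /= prodr_const card_ord exprVn.
move=> hq.
have h1 : (c / B) ^+ n.+1 <= \prod_j (q j / N X) + C * del.
  apply: le_trans (_ : _ <= \prod_j (q j / N X) + C * (eps / N X)) _; last first.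
    by rewrite lerD2l ler_wpM2l.
  apply: le_trans hq; rewrite ler_pdivlMr ?exprn_gt0 // -exprMn.
  apply: le_trans hprod.
  have hcN : c / B * N X <= c * expR T.
    by rewrite -mulrA ler_pM2l // mulrC ler_pdivrMr // mulrC.
  apply: lerXn2r hcN; rewrite nnegrE mulr_ge0 ?divr_ge0 ?expR_ge0 //; exact: ltW.
have h2 : Th * \prod_j (q j / N X) <= S.
  rewrite big_split /= prodr_const card_ord exprVn mulrA ler_pdivrMr ?exprn_gt0 //.
  have := prod_le_supnorm KP NP d_gt0 lpsi NXp; rewrite card_ord.
  apply: le_trans; rewrite /Th -big_split /=; apply: ler_prod => j _.
  by rewrite mulr_ge0 //=; have [_ _ _] := hbt j; apply.
apply: le_trans (ler_wpM2l Th0 h1) _; rewrite mulrDr; exact: lerD.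
Qed.
End UpperBound.

(** * Lower bounds from explicit families *)

Section LowerBound.
Variables (R : realType) (K : comNzRingType) (mK : K -> R)
  (iota : {rmorphism R -> K}) (u v : K -> R).
Hypothesis KP : real_or_complex mK iota u v.
Variables (d : nat) (N : 'rV[K]_d -> R).
Hypothesis NP : gauge mK iota N.
Hypothesis d_gt0 : (0 < d)%N.
Variable M : R.
Hypothesis M_ge0 : 0 <= M.
Hypothesis polar : forall n (psi : 'I_n -> 'rV[K]_d -> K),
  (forall i, is_linear_functional (psi i)) ->
  \prod_i supnorm mK N (psi i) <= M ^+ n * supnorm mK N (fun x => \prod_i psi i x).

(** The point [x0], where no functional vanishes, ensures that the product has positive norm. *)
Lemma cconst_ge_family (a b : R) (I : finType) (psi : I -> 'rV[K]_d -> K)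
    (x0 : 'rV[K]_d) : (0 < #|I|)%N ->
  (forall i, is_linear_functional (psi i)) -> 0 <= a -> 0 < b ->
  0 < N x0 -> (forall i, 0 < mK (psi i x0)) ->
  (forall i, a <= supnorm mK N (psi i)) ->
  (forall x, N x = 1 -> \prod_i mK (psi i x) <= b ^+ #|I|) ->
  a / b <= cconst mK N.
Proof.
move=> I0 lpsi a0 b0 Nx0 psix0 ha hb.
apply: (cconst_ge KP NP d_gt0 M_ge0 polar I0 lpsi); first by rewrite divr_ge0 // ltW.
- rewrite -(pmulr_lgt0 _ (exprn_gt0 #|I| Nx0)).
  apply: lt_le_trans (prod_le_supnorm KP NP d_gt0 lpsi Nx0).
  exact: prodr_gt0.
apply: le_trans (_ : (a / b) ^+ #|I| * b ^+ #|I| <= _).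
  rewrite ler_wpM2l ?exprn_ge0 ?divr_ge0 // ?(ltW b0) //.
  by apply: (supnorm_le KP NP d_gt0) => x x1; rewrite (modulus_prod KP) hb.
rewrite -exprMn divfK ?gt_eqF // -prodr_const; apply: ler_prod => i _.
by rewrite a0 ha.
Qed.

(** Each sign functional takes the value [d] at its own sign vector, so its norm is at least
    [d / G]. On the unit sphere the geometric mean of all of them is at most the quadratic mean,
    which is the Euclidean norm and hence at most [D]. *)
Lemma cconst_ge_signs (G D : R) : 0 < G -> 0 < D ->
  (forall eps : {ffun 'I_d -> bool}, N (\row_i iota ((-1) ^+ eps i)) <= G) ->
  (forall x : 'rV[K]_d, \sum_i mK (x 0 i) ^+ 2 <= D ^+ 2 * N x ^+ 2) ->
  d%:R / G / D <= cconst mK N.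
Proof.
move=> G0 D0 hG hD; pose i0 := Ordinal d_gt0.
pose psi (eps : {ffun 'I_d -> bool}) (x : 'rV[K]_d) := \sum_i iota ((-1) ^+ eps i) * x 0 i.
have lpsi eps : is_linear_functional (psi eps).
  move=> c x y; rewrite /psi mulr_sumr -big_split; apply: eq_bigr => i _ /=.
  by rewrite !mxE; ring.
have I0 : (0 < #|{ffun 'I_d -> bool}|)%N by apply/card_gt0P; exists [ffun=> true].
have sgnK (e : bool) : iota ((-1) ^+ e) * iota ((-1) ^+ e) = 1.
  by rewrite -rmorphM -expr2 sqrr_sign rmorph1.
have Nsgn (eps : {ffun 'I_d -> bool}) : 0 < N (\row_i iota ((-1) ^+ eps i)).
  apply: lt_le_trans (coord_le_gauge NP _ i0).
  by rewrite mxE (modulus_real KP) normrX normrN1 expr1n.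
apply: (@cconst_ge_family _ _ _ psi (delta_mx 0 i0)) => //.
- by rewrite divr_ge0 // ltW.
- apply: lt_le_trans (coord_le_gauge NP _ i0).
  by rewrite mxE !eqxx (modulus1 KP).
- move=> eps; rewrite /psi (bigD1 i0) //= big1 ?addr0 => [|i /negPf ne].
    by rewrite mxE !eqxx mulr1 (modulus_real KP) normrX normrN1 expr1n.
  by rewrite mxE ne andbF mulr0.
- move=> eps; rewrite ler_pdivrMr //.
  apply: le_trans (_ : supnorm mK N (psi eps) * N (\row_i iota ((-1) ^+ eps i)) <= _).
    have := functional_le_supnorm KP NP d_gt0 (lpsi eps) (Nsgn eps).
    apply: le_trans; rewrite /psi.
    under eq_bigr do rewrite mxE sgnK.
    by rewrite sumr_const card_ord -(rmorph1 iota) -rmorphMn (modulus_real KP) normr_nat.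
  by rewrite ler_wpM2l // (supnorm_ge0 KP NP d_gt0) //; exact: (functional_bounded KP NP).
move=> x x1.
have P0 : 0 <= \prod_eps mK (psi eps x) by apply: prodr_ge0 => eps _; exact: (modulus_ge0 KP).
rewrite -(@ler_pXn2r _ 2) ?nnegrE // ?exprn_ge0 // ?(ltW D0) //.
rewrite -prodrXl exprAC; apply: prod_le_mean_exp => // [eps|]; first exact: sqr_ge0.
have part (w : K -> R) : {morph w : y z / y + z} -> (forall r z, w (iota r * z) = r * w z) ->
    \sum_eps w (psi eps x) ^+ 2 = (\sum_i w (x 0 i) ^+ 2) *+ #|{ffun 'I_d -> bool}|.
  move=> wD wZ; have w0 : w 0 = 0 by have := wZ 0 0; rewrite mulr0 mul0r.
  rewrite -sum_sign_sqr; apply: eq_bigr => eps _; congr (_ ^+ 2).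
  by rewrite /psi (big_morph w wD w0); apply: eq_bigr => i _; rewrite wZ.
under eq_bigr do rewrite (modulus_sqr KP).
rewrite big_split /= (part _ (realpartD KP) (realpartZ KP)).
rewrite (part _ (imagpartD KP) (imagpartZ KP)) -mulrnDl -big_split /=.
apply: ler_wMn2r; have := hD x; rewrite x1 expr1n mulr1.
by apply: le_trans; apply: ler_sum => i _; rewrite (modulus_sqr KP).
Qed.

End LowerBound.

(** * The spaces l_p^d *)

Section PowerSums.
Variables (R : realType) (d : nat) (t : 'I_d -> R) (p : R).
Hypotheses (t_ge0 : forall i, 0 <= t i) (p_ge1 : 1 <= p).

Let p_gt0 : 0 < p. Proof. exact: lt_le_trans p_ge1. Qed.
Let p_neq0 : p != 0. Proof. by rewrite gt_eqF. Qed.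
Let S := \sum_i t i `^ p.
Let S_ge0 : 0 <= S. Proof. by apply: sumr_ge0 => i _; exact: powR_ge0. Qed.

Lemma coord_le_lp i : t i <= S `^ p^-1.
Proof.
rewrite -[leLHS](powR_powRV p_neq0) // ge0_ler_powR ?nnegrE ?invr_ge0 ?powR_ge0 ?(ltW p_gt0) //.
by rewrite /S (bigD1 i) //= lerDl sumr_ge0 // => k _; exact: powR_ge0.
Qed.

Let S0_t0 : S = 0 -> forall i, t i = 0.
Proof.
move=> S0 i; apply: le_anti; rewrite t_ge0 andbT; apply: le_trans (coord_le_lp i) _.
by rewrite S0 powR0 // invr_eq0.
Qed.

Lemma l2_le_lp : p <= 2 -> \sum_i t i ^+ 2 <= (S `^ p^-1) ^+ 2.
Proof.
move=> p2; move: (S_ge0); rewrite le_eqVlt => /predU1P[/esym S0|S0].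
  by rewrite big1 ?sqr_ge0 // => i _; rewrite S0_t0 // expr0n.
set n := S `^ p^-1; have n0 : 0 < n by exact: powR_gt0.
have np : n `^ p = S by rewrite powRV_powR.
(* After normalisation every [t i / n] is at most 1, so its square is at most its [p]-th power. *)
rewrite -[leRHS]mul1r -ler_pdivrMr ?exprn_gt0 // mulr_suml.
apply: le_trans (_ : \sum_i t i `^ p / S <= _); last first.
  by rewrite -mulr_suml divff // gt_eqF.
apply: ler_sum => i _; rewrite -np -exprVn -exprMn.
have -> : t i `^ p / n `^ p = (t i / n) `^ p.
  by rewrite powRM ?invr_ge0 ?(ltW n0) // -[in RHS]powR_inv1 ?(ltW n0) // -powRrM mulN1r powRN.
have tn0 : 0 <= t i / n by rewrite divr_ge0 // ltW.
have tn1 : t i / n <= 1 by rewrite ler_pdivrMr // mul1r coord_le_lp.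
move: tn0; rewrite le_eqVlt => /predU1P[<-|tn0]; first by rewrite expr0n /= powR_ge0.
by rewrite -powR_mulrn ?(ltW tn0) // ger_powR // tn0.
Qed.

Lemma l2_le_lp_dim : (0 < d)%N -> 2 <= p ->
  \sum_i t i ^+ 2 <= (d%:R `^ (2^-1 - p^-1)) ^+ 2 * (S `^ p^-1) ^+ 2.
Proof.
move=> d0 p2; move: (S_ge0); rewrite le_eqVlt => /predU1P[/esym S0|S0].
  by rewrite big1 => [|i _]; [apply: mulr_ge0; exact: sqr_ge0|rewrite S0_t0 // expr0n].
have dR : 0 < d%:R :> R by rewrite ltr0n.
set mu := S / d%:R; have mu0 : 0 < mu by rewrite divr_gt0.
have th : 0 <= 2 / p <= 1.
  by rewrite divr_ge0 ?(ltW p_gt0) //= ler_pdivrMr // mul1r.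
have h : \sum_i (t i `^ p / mu) `^ (2 / p) <= d%:R.
  apply: le_trans (_ : \sum_i (1 - 2 / p + 2 / p * (t i `^ p / mu)) <= _).
    by apply: ler_sum => i _; apply: powR_le_affine; rewrite // divr_ge0 ?powR_ge0 ?(ltW mu0).
  rewrite big_split /= sumr_const card_ord -mulr_sumr -mulr_suml -/S.
  have -> : S / mu = d%:R by rewrite /mu; field; rewrite !gt_eqF.
  by rewrite -[_ *+ d]mulr_natr -mulrDl addrNK mul1r.
have e i : (t i `^ p / mu) `^ (2 / p) = t i ^+ 2 / mu `^ (2 / p).
  rewrite powRM ?invr_ge0 ?powR_ge0 ?(ltW mu0) //.
  rewrite -powRrM mulrCA divff // mulr1 powR_mulrn //; congr (_ * _).
  by rewrite -[in LHS]powR_inv1 ?(ltW mu0) // -powRrM mulN1r powRN.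
rewrite (eq_bigr _ (fun i _ => e i)) -mulr_suml ler_pdivrMr ?powR_gt0 // in h.
apply: le_trans h _.
have -> : (S `^ p^-1) ^+ 2 = S `^ (2 / p).
  by rewrite -powR_mulrn ?powR_ge0 // -powRrM mulrC.
have -> : mu `^ (2 / p) = S `^ (2 / p) * d%:R `^ (- (2 / p)).
  rewrite /mu powRM ?invr_ge0 ?(ltW dR) //.
  by rewrite -[in LHS](powR_inv1 (ltW dR)) -powRrM mulN1r.
have -> : (d%:R `^ (2^-1 - p^-1)) ^+ 2 = d%:R * d%:R `^ (- (2 / p)) :> R.
  rewrite -powR_mulrn ?powR_ge0 // -powRrM -{2}[d%:R](powRr1 (ltW dR)) -powRD.
    by congr (_ `^ _); field; rewrite gt_eqF.
  by rewrite (gt_eqF dR) implybT.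
by rewrite mulrCA mulrC.
Qed.
End PowerSums.

(** Raise [|y| <= p * expR (|y| / p)] to the power [p]. *)
Lemma powR_le_cosh (R : realType) (p y : R) : 1 <= p ->
  `|y| `^ p <= 2 * p `^ p * cosh y.
Proof.
move=> p1; have p0 : 0 < p by lra.
have h : `|y| <= p * expR (`|y| / p).
  rewrite mulrC -ler_pdivrMr //; apply: le_trans (expR_ge1Dx _); lra.
apply: le_trans (_ : (p * expR (`|y| / p)) `^ p <= _).
  by rewrite ge0_ler_powR ?nnegrE // ?mulr_ge0 ?expR_ge0 ?(ltW p0).
rewrite powRM ?expR_ge0 ?(ltW p0) // -expRM divfK ?gt_eqF //.
rewrite [2 * _]mulrC -mulrA ler_wpM2l ?powR_ge0 //.
exact: expR_norm_le_cosh.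
Qed.

Section Scalars.
Variables (R : realType) (K : comNzRingType) (mK : K -> R)
  (iota : {rmorphism R -> K}) (u v : K -> R).
Hypothesis KP : real_or_complex mK iota u v.

Let mK_sign (b : bool) : mK (iota ((-1) ^+ b)) = 1.
Proof. by rewrite (modulus_real KP) normrX normrN1 expr1n. Qed.

(** * Finite exponents *)

Section FiniteExponent.
Variables (p : R) (d : nat).
Hypotheses (p_ge1 : 1 <= p) (d_gt0 : (0 < d)%N).

Let p_gt0 : 0 < p. Proof. exact: lt_le_trans p_ge1. Qed.
Let p_neq0 : p != 0. Proof. by rewrite gt_eqF. Qed.
Let dR_gt0 : 0 < d%:R :> R. Proof. by rewrite ltr0n. Qed.
Let N : 'rV[K]_d -> R := lpnorm mK p (d := d).

Lemma lpnorm_gauge : gauge mK iota N.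
Proof.
split=> [r x|x i]; last exact: (coord_le_lp (fun i => modulus_ge0 KP (x 0 i)) p_ge1).
rewrite /N /lpnorm; under eq_bigr do
  rewrite mxE (modulusM KP) (modulus_real KP) powRM ?(modulus_ge0 KP) //.
rewrite -mulr_sumr powRM ?powR_ge0 ?sumr_ge0 // => [|i _]; last exact: powR_ge0.
by rewrite powR_powRV.
Qed.

Let N_sign (eps : {ffun 'I_d -> bool}) :
  N (\row_i iota ((-1) ^+ eps i)) <= d%:R `^ p^-1.
Proof.
rewrite /N /lpnorm; under eq_bigr do rewrite mxE mK_sign powR1.
by rewrite sumr_const card_ord.
Qed.

Let C : R := (2 * p `^ p * expR (1 / 4)) `^ p^-1.

Let C_gt0 : 0 < C.
Proof. by rewrite powR_gt0 // !mulr_gt0 ?powR_gt0 ?expR_gt0. Qed.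

Let N_le_cosh (y : 'I_d -> R) : N (\row_i iota (y i)) <=
  C * d%:R `^ p^-1 * expR ((\sum_i cosh (1 * y i)) / (d%:R * expR (1 ^+ 2 / 4))).
Proof.
rewrite expr1n; set T := _ / (_ * _).
have E0 := expR_gt0 (1 / 4 : R).
have T0 : 0 <= T.
  by rewrite divr_ge0 ?sumr_ge0 ?mulr_ge0 ?expR_ge0 // => i _; exact: cosh_ge0.
have hsum : \sum_i `|y i| `^ p <= 2 * p `^ p * expR (1 / 4) * d%:R * expR T.
  apply: le_trans (_ : \sum_i 2 * p `^ p * cosh (1 * y i) <= _).
    by apply: ler_sum => i _; rewrite mul1r; exact: powR_le_cosh.
  have eT : \sum_i cosh (1 * y i) = d%:R * expR (1 / 4) * T.
    by rewrite /T mulrC divfK // gt_eqF // mulr_gt0.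
  rewrite -mulr_sumr eT.
  have -> : 2 * p `^ p * (d%:R * expR (1 / 4) * T)
     = 2 * p `^ p * expR (1 / 4) * d%:R * T by ring.
  rewrite ler_wpM2l ?mulr_ge0 ?powR_ge0 ?expR_ge0 //.
  by apply: le_trans (expR_ge1Dx T); rewrite lerDr.
rewrite /N /lpnorm; under eq_bigr do rewrite mxE (modulus_real KP).
have S0 : 0 <= \sum_i `|y i| `^ p by apply: sumr_ge0 => i _; exact: powR_ge0.
apply: le_trans (_ : (2 * p `^ p * expR (1 / 4) * d%:R * expR T) `^ p^-1 <= _).
  rewrite ge0_ler_powR ?nnegrE // ?invr_ge0 ?(ltW p_gt0) //.
  exact: le_trans hsum.
rewrite powRM ?expR_ge0 // ?mulr_ge0 ?powR_ge0 ?expR_ge0 //.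
rewrite powRM ?mulr_ge0 ?powR_ge0 ?expR_ge0 // -/C.
rewrite ler_wpM2l ?mulr_ge0 ?powR_ge0 ?(ltW C_gt0) //.
rewrite -expRM ler_expR ler_piMr // invf_le1 //.
Qed.

Let polar D : 0 < D -> (forall x : 'rV[K]_d, \sum_i mK (x 0 i) ^+ 2 <= D ^+ 2 * N x ^+ 2) ->
  forall n (psi : 'I_n -> 'rV[K]_d -> K),
  (forall i, is_linear_functional (psi i)) ->
  \prod_i supnorm mK N (psi i) <=
  (2 * expR 9 * D * (C * d%:R `^ p^-1)) ^+ n * supnorm mK N (fun x => \prod_i psi i x).
Proof.
move=> D0 hD n psi lpsi.
have B0 : 0 < C * d%:R `^ p^-1 by apply: mulr_gt0; [exact: C_gt0|exact: powR_gt0].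
exact: (polarization_bound KP lpnorm_gauge d_gt0 D0 B0 hD N_le_cosh).
Qed.

Let M_ge0 D : 0 < D -> 0 <= 2 * expR 9 * D * (C * d%:R `^ p^-1).
Proof.
move=> D0; apply: mulr_ge0; first by rewrite !mulr_ge0 ?expR_ge0 // ltW.
by apply: mulr_ge0; exact: powR_ge0.
Qed.

Let euclid_ge2 : 2 <= p ->
  forall x : 'rV[K]_d, \sum_i mK (x 0 i) ^+ 2 <= (d%:R `^ (2^-1 - p^-1)) ^+ 2 * N x ^+ 2.
Proof. by move=> p2 x; exact: (l2_le_lp_dim (fun i => modulus_ge0 KP (x 0 i))). Qed.

Let euclid_le2 : p <= 2 ->
  forall x : 'rV[K]_d, \sum_i mK (x 0 i) ^+ 2 <= 1 ^+ 2 * N x ^+ 2.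
Proof.
by move=> p2 x; rewrite expr1n mul1r; exact: (l2_le_lp (fun i => modulus_ge0 KP (x 0 i))).
Qed.

Let sqrt_dim : d%:R `^ (2^-1 - p^-1) * d%:R `^ p^-1 = Num.sqrt d%:R :> R.
Proof.
by rewrite -powRD ?(gt_eqF dR_gt0) ?implybT // addrNK powR12_sqrt // ltW.
Qed.

(** With [G = d]^ p^-1[and]D = d [^ (2^-1 - p^-1)], the product [G * D] is [sqrt d]: it divides [d]
    in the lower bound and multiplies the constants in the upper one. *)
Lemma cconst_lp_ge2 : 2 <= p ->
  Num.sqrt d%:R <= cconst mK N <= 2 * expR 9 * C * Num.sqrt d%:R.
Proof.
move=> p2; have D0 : 0 < d%:R `^ (2^-1 - p^-1) :> R by exact: powR_gt0.
apply/andP; split.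
  have G0 : 0 < d%:R `^ p^-1 :> R by exact: powR_gt0.
  have := cconst_ge_signs KP lpnorm_gauge d_gt0 (M_ge0 D0) (polar D0 (euclid_ge2 p2))
    G0 D0 N_sign (euclid_ge2 p2).
  apply: le_trans; rewrite -mulrA -invfM [X in _ / X]mulrC sqrt_dim.
  by rewrite -[X in _ <= X / _]sqr_sqrtr ?(ltW dR_gt0) // expr2 mulfK // gt_eqF // sqrtr_gt0.
apply: le_trans (cconst_le KP lpnorm_gauge d_gt0 (M_ge0 D0) (polar D0 (euclid_ge2 p2))) _.
rewrite -sqrt_dim le_eqVlt; apply/orP; left; apply/eqP; ring.
Qed.

Lemma cconst_lp_le2 : p <= 2 ->
  d%:R `^ p^-1 <= cconst mK N <= 2 * expR 9 * C * d%:R `^ p^-1.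
Proof.
move=> p2; have D0 : 0 < 1 :> R by [].
apply/andP; split; last first.
  apply: le_trans (cconst_le KP lpnorm_gauge d_gt0 (M_ge0 D0) (polar D0 (euclid_le2 p2))) _.
  rewrite le_eqVlt; apply/orP; left; apply/eqP; ring.
have b0 : 0 < d%:R `^ (- p^-1) :> R by exact: powR_gt0.
have -> : d%:R `^ p^-1 = 1 / d%:R `^ (- p^-1) :> R by rewrite powRN div1r invrK.
pose psi (i : 'I_d) (x : 'rV[K]_d) := x 0 i.
have lpsi i : is_linear_functional (psi i) by exact: coord_functional.
have N1 : 0 < N (const_mx 1).
  apply: lt_le_trans (coord_le_gauge lpnorm_gauge _ (Ordinal d_gt0)).
  by rewrite mxE (modulus1 KP).
apply: (cconst_ge_family KP lpnorm_gauge d_gt0 (M_ge0 D0) (polar D0 (euclid_le2 p2))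
  (psi := psi) (x0 := const_mx 1)) => //.
- by rewrite card_ord.
- by move=> i; rewrite /psi mxE (modulus1 KP).
- move=> i; have Ne : N (delta_mx 0 i) = 1.
    rewrite /N /lpnorm (bigD1 i) //= big1 => [|k /negPf ki].
      by rewrite mxE !eqxx (modulus1 KP) powR1 addr0 powR1.
    by rewrite mxE ki andbF (modulus0 KP) powR0.
  have := le_supnorm (functional_bounded KP lpnorm_gauge (lpsi i)) Ne.
  by rewrite /psi mxE !eqxx (modulus1 KP).
move=> x x1.
have S1 : \sum_i mK (x 0 i) `^ p = 1.
  rewrite -[LHS](powRV_powR p_neq0); last by apply: sumr_ge0 => i _; exact: powR_ge0.
  by rewrite -/(lpnorm mK p x) -/(N x) x1 powR1.
(* AM-GM on the [p]-th powers, whose sum is 1 on the unit sphere. *)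
have h : \prod_i mK (x 0 i) `^ p <= (d%:R^-1) ^+ #|'I_d|.
  apply: prod_le_mean_exp => [|i|]; [by rewrite card_ord|exact: powR_ge0|].
  by rewrite S1 card_ord -[_ *+ d]mulr_natr mulVf // gt_eqF.
have P0 : 0 <= \prod_i mK (psi i x) by apply: prodr_ge0 => i _; exact: (modulus_ge0 KP).
rewrite -[leLHS](powR_powRV p_neq0) // -prod_powR => [|i]; last exact: (modulus_ge0 KP).
apply: (@le_trans _ _ (((d%:R^-1) ^+ #|'I_d|) `^ p^-1)).
  rewrite ge0_ler_powR ?nnegrE ?invr_ge0 ?(ltW p_gt0) ?exprn_ge0 ?invr_ge0 //.
  by apply: prodr_ge0 => i _; exact: powR_ge0.
rewrite -powR_mulrn ?invr_ge0 // -powR_mulrn ?powR_ge0 // -!powRrM.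
by rewrite -[X in X `^ _ <= _](powR_inv1 (ltW dR_gt0)) -powRrM mulN1r mulrC mulNr.
Qed.
End FiniteExponent.

(** * The supremum norm *)

Section InfiniteExponent.
Variable d : nat.
Hypothesis d_ge2 : (2 <= d)%N.

Let d_gt0 : (0 < d)%N. Proof. exact: leq_trans d_ge2. Qed.
Let dR_gt0 : 0 < d%:R :> R. Proof. by rewrite ltr0n. Qed.
Let N : 'rV[K]_d -> R := linfnorm mK (d := d).

Lemma linfnorm_gauge : gauge mK iota N.
Proof.
split=> [r x|x i]; last exact: (le_bigmax _ (fun i => mK (x 0 i)) i).
rewrite /N /linfnorm (big_morph (fun z => `|r| * z) (id1 := 0) (op1 := Num.max)).
- by apply: eq_bigr => i _; rewrite mxE (modulusM KP) (modulus_real KP).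
- by move=> y z; rewrite maxr_pMr.
- by rewrite mulr0.
Qed.

Let N_sign (eps : {ffun 'I_d -> bool}) : N (\row_i iota ((-1) ^+ eps i)) <= 1.
Proof. by apply: bigmax_le => // i _; rewrite mxE mK_sign. Qed.

Let lnd_ge : 1 / 2 <= ln d%:R :> R.
Proof.
have h : ln (2^-1 : R) <= 2^-1 - 1 by apply: ln_leB1; rewrite invr_gt0.
rewrite lnV ?posrE // in h.
apply: (@le_trans _ _ (ln 2)); first by lra.
by rewrite ler_ln ?posrE // ler_nat.
Qed.

Let lnd_gt0 : 0 < ln d%:R :> R.
Proof. by apply: lt_le_trans lnd_ge; rewrite divr_gt0. Qed.

(** Keeps [expR (lambda ^+ 2 / 4)] below [d], while the penalty controls the largest coordinate by a
    multiple of [ln d / lambda = sqrt (ln d)]. *)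
Let lambda : R := Num.sqrt (ln d%:R).
Let lambda_sqr : lambda ^+ 2 = ln d%:R. Proof. by rewrite sqr_sqrtr // ltW. Qed.
Let lambda_gt0 : 0 < lambda. Proof. by rewrite sqrtr_gt0. Qed.

Let N_le_cosh (y : 'I_d -> R) : N (\row_i iota (y i)) <=
  3 * lambda * expR ((\sum_i cosh (lambda * y i)) / (d%:R * expR (lambda ^+ 2 / 4))).
Proof.
set E := expR (_ / 4); have E0 : 0 < E by exact: expR_gt0.
set T := _ / _.
have T0 : 0 <= T.
  by rewrite divr_ge0 ?sumr_ge0 ?mulr_ge0 ?(ltW E0) // => i _; exact: cosh_ge0.
apply: bigmax_le => [|i _]; first by rewrite !mulr_ge0 ?expR_ge0 ?(ltW lambda_gt0).
rewrite mxE (modulus_real KP).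
have h1 : expR (lambda * `|y i|) <= 2 * \sum_k cosh (lambda * y k).
  apply: le_trans (_ : 2 * cosh (lambda * y i) <= _); last first.
    rewrite ler_pM2l // [leRHS](bigD1 i) //= lerDl sumr_ge0 // => k _; exact: cosh_ge0.
  have -> : lambda * `|y i| = `|lambda * y i| by rewrite normrM gtr0_norm.
  exact: expR_norm_le_cosh.
have eT : \sum_k cosh (lambda * y k) = d%:R * E * T.
  by rewrite /T mulrC divfK // gt_eqF // mulr_gt0.
have E_le : E <= d%:R.
  rewrite -[leRHS]lnK ?posrE // /E ler_expR lambda_sqr; have := lnd_gt0; lra.
have d2 : 2 <= d%:R :> R by rewrite ler_nat.
(* The 3 arises from [2 * d * E <= d ^+ 3], since both 2 and [E] are at most [d]. *)
have h2 : expR (lambda * `|y i|) <= expR (3 * lambda ^+ 2 + T).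
  apply: le_trans h1 _; rewrite eT expRD lambda_sqr expRM_natl lnK ?posrE //.
  rewrite mulrA; apply: ler_pM => //; first by rewrite !mulr_ge0 // ltW.
    rewrite !exprS expr0 mulr1; apply: ler_pM => //; first by rewrite mulr_ge0 // ltW.
    by rewrite ler_pM2l.
  by apply: le_trans (expR_ge1Dx T); rewrite lerDr.
rewrite ler_expR in h2.
rewrite -(ler_pM2l lambda_gt0); apply: le_trans h2 _.
have -> : lambda * (3 * lambda * expR T) = 3 * lambda ^+ 2 * expR T by ring.
have h3 := expR_ge1Dx T.
have : 3 * lambda ^+ 2 * (1 + T) <= 3 * lambda ^+ 2 * expR T.
  by rewrite ler_wpM2l // mulr_ge0 // sqr_ge0.
(* Since [ln d >= 1 / 2], the additive [T] is absorbed into [3 * ln d * T]. *)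
apply: le_trans; rewrite lambda_sqr; have := lnd_ge; nra.
Qed.

Let euclid (x : 'rV[K]_d) :
  \sum_i mK (x 0 i) ^+ 2 <= (Num.sqrt d%:R) ^+ 2 * N x ^+ 2.
Proof.
rewrite sqr_sqrtr // -[d in leRHS]card_ord mulr_natl -sumr_const; apply: ler_sum => i _.
have h := coord_le_gauge linfnorm_gauge x i.
by apply: lerXn2r => //; rewrite nnegrE ?(modulus_ge0 KP) ?(gauge_ge0 KP linfnorm_gauge).
Qed.

Let D_gt0 : 0 < Num.sqrt d%:R :> R. Proof. by rewrite sqrtr_gt0. Qed.
Let B_gt0 : 0 < 3 * lambda. Proof. by rewrite mulr_gt0. Qed.

Let M_ge0 : 0 <= 2 * expR 9 * Num.sqrt d%:R * (3 * lambda).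
Proof. by rewrite !mulr_ge0 ?expR_ge0 ?(ltW lambda_gt0). Qed.

Let polar := polarization_bound KP linfnorm_gauge d_gt0 D_gt0 B_gt0 euclid N_le_cosh.

Lemma cconst_linf : Num.sqrt d%:R <= cconst mK N
  <= 6 * expR 9 * Num.sqrt (d%:R * ln d%:R).
Proof.
apply/andP; split.
  have := cconst_ge_signs KP linfnorm_gauge d_gt0 M_ge0 polar ltr01 D_gt0 N_sign euclid.
  apply: le_trans.
  by rewrite divr1 -[X in _ <= X / _]sqr_sqrtr // expr2 mulfK // gt_eqF.
apply: le_trans (cconst_le KP linfnorm_gauge d_gt0 M_ge0 polar) _.
rewrite sqrtrM // -/lambda le_eqVlt; apply/orP; left; apply/eqP; ring.
Qed.
End InfiniteExponent.

Lemma theorem2p1_scalars : theorem2p1_for mK.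
Proof.
split=> [p p1|]; last split.
- have C0 : 0 < 2 * expR 9 * (2 * p `^ p * expR (1 / 4)) `^ p^-1.
    have p0 : 0 < p by exact: lt_le_trans p1.
    by rewrite !mulr_gt0 ?powR_gt0 ?expR_gt0 // !mulr_gt0 ?powR_gt0 ?expR_gt0.
  split=> p2; split.
  + by eexists; split=> [|d d1]; [exact: C0|case/andP: (cconst_lp_ge2 p1 d1 p2)].
  + by exists 1; split=> // d d1; rewrite mul1r; case/andP: (cconst_lp_ge2 p1 d1 p2).
  + by eexists; split=> [|d d1]; [exact: C0|case/andP: (cconst_lp_le2 p1 d1 p2)].
  + by exists 1; split=> // d d1; rewrite mul1r; case/andP: (cconst_lp_le2 p1 d1 p2).
- by exists 1; split=> // d d2; rewrite mul1r; case/andP: (cconst_linf d2).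
- exists (6 * expR 9); split=> [|d d2]; first by rewrite mulr_gt0 ?expR_gt0.
  by case/andP: (cconst_linf d2).
Qed.
End Scalars.

(* K = R (modulus: absolute value) and K = C = R[i] (modulus: complex modulus) *)
Theorem theorem2p1 (R : realType) :
  theorem2p1_for (fun x : R => `|x|) /\
  theorem2p1_for (fun z : R[i] => Normc.normc z).
Proof.
split.
  apply: (@theorem2p1_scalars R R _ idfun id (fun=> 0)).
  split=> //; try by move=> *; rewrite ?normrM ?addr0 ?mulr0.
  - exact: ler_normD.
  - by move=> z; rewrite expr0n /= addr0 real_normK ?num_real.
apply: (@theorem2p1_scalars R R[i] _ (real_complex R) (@complex.Re R) (@complex.Im R)).
split.
- by case=> a b; exact: sqrtr_ge0.
- exact: Normc.normcM.
- by move=> r; rewrite /= expr0n /= addr0 sqrtr_sqr.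
- exact: le_normcD.
- by case=> a b; rewrite /= sqr_sqrtr // addr_ge0 ?sqr_ge0.
- by case=> a b [a' b'].
- by case=> a b [a' b'].
- by move=> r [a b]; rewrite /= mul0r subr0.
- by move=> r [a b]; rewrite /= mul0r addr0.
Qed.
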